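(* Let $m\ge1$ be an integer and let $f:\mathbb{N}\to\mu_m\cup\{0\}\subseteq\mathbb{C}$ be a multiplicative function, where $\mu_m:=\{x\in\mathbb{C}:x^m=1\}$. Let $a\in\mu_m\cup\{0\}$ be such that the set $\mathcal{A}_{a,f}:=\{n\in\mathbb{N}:f(n)=a\}$ has positive lower density. Then, with $\mathcal{A}=\mathcal{A}_{a,f}$, $$\bigcap_{\psi\in\mathcal{M}}\mathcal{K}_{\mathcal{A}}(\psi)=BAD.\qquad( * )$$ In particular, $( * )$ holds for each of the following sets $\mathcal{A}$: (a) the set of squarefree numbers $\mathcal{A}=\{n\in\mathbb{N}:\mu^2(n)=1\}$, where $\mu$ is the Möbius function; (b) $\mathcal{A}=\{n\in\mathbb{N}:\omega(n)\equiv a\pmod m\}$, for integers $a$ and $m\ge1$, where $\omega(n)$ is the number of prime factors of $n$ counted without multiplicity; (c) $\mathcal{A}=\{n\in\mathbb{N}:\Omega(n)\equiv a\pmod m\}$, for integers $a$ and $m\ge1$, where $\Omega(n)$ is the number of prime factors of $n$ counted with multiplicity; (d) any set $\mathcal{A}\subseteq\mathbb{N}$ that contains an arithmetic progression, i.e. such that for some fixed $m,a\in\mathbb{N}$, $\mathcal{A}\supseteq\{bm+a:b\in\mathbb{N}\}$.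
   Context: $\mathbb{N}$ is the set of positive integers, $\lVert x\rVert$ the distance from $x$ to the nearest integer, $\lambda$ the Lebesgue measure; ''monotonically decreasing'' means non-increasing. A set $\mathcal{A}\subseteq\mathbb{N}$ has positive lower density if $\liminf_{N\to\infty}\frac{\#\{n\le N:n\in\mathcal{A}\}}{N}>0$. A function $f$ is multiplicative if $f(1)=1$ and $f(nn')=f(n)f(n')$ for coprime $n,n'$. $BAD:=\{\alpha\in[0,1):\liminf_{n\to\infty}n\lVert n\alpha\rVert>0\}$. $\mathcal{M}:=\{\psi:\mathbb{N}\to[0,\infty)\text{ monotonically decreasing},\ \sum_{n\in\mathbb{N}}\psi(n)=\infty\}$. For $\mathcal{A}\subseteq\mathbb{N}$, $\psi:\mathbb{N}\to[0,\infty)$ and $\alpha\in\mathbb{R}$, $T_{\mathcal{A}}(\psi,\alpha):=\{\gamma\in[0,1):\lVert n\alpha+\gamma\rVert\le\psi(n)\text{ for infinitely many }n\in\mathcal{A}\}$, and $\mathcal{K}_{\mathcal{A}}(\psi):=\{\alpha\in[0,1):\lambda(T_{\mathcal{A}}(\psi,\alpha))=1\}$. *)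

(* Defs.v *)
(* MathComp-Analysis, with the complex numbers R[i] of mathcomp-real-closed. *)
From HB Require Import structures.
From mathcomp Require Import all_boot all_order all_algebra.
From mathcomp Require Import all_classical all_reals all_analysis.
From mathcomp Require Import complex.

Set Implicit Arguments.
Unset Strict Implicit.
Unset Printing Implicit Defensive.

Import Order.TTheory GRing.Theory Num.Theory.
Import numFieldNormedType.Exports.

Local Open Scope classical_set_scope.
Local Open Scope ring_scope.

(* The positive integers. Arithmetic functions below have type [nat -> _]; only
   their values on [posN] are constrained or used. *)
Definition posN : set nat := [set n | (0 < n)%N].

Section Kurzweil.
Variable R : realType.
Implicit Types (x alpha : R) (psi : nat -> R) (A : set nat).

Definition dist_int x : R := inf (range (fun k : int => `|x - k%:~R|)).

(* The term of index 0 is irrelevant to the limit inferior, which is taken in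
   the extended reals. *)
Definition BAD : set R :=
  [set alpha | 0 <= alpha < 1 /\
    (0 < limn_einf (fun n => (n%:R * dist_int (n%:R * alpha))%:E))%E].

Definition divergent_decreasing : set (nat -> R) :=
  [set psi | [/\ forall n, posN n -> 0 <= psi n,
                 forall n n', posN n -> (n <= n')%N -> psi n' <= psi n &
                 (\sum_(1 <= n <oo) (psi n)%:E = +oo)%E]].

Definition approx_set A psi alpha : set R :=
  [set gamma | 0 <= gamma < 1 /\
    infinite_set [set n | A n /\ dist_int (n%:R * alpha + gamma) <= psi n]].

Definition kurzweil_set A psi : set R :=
  [set alpha | 0 <= alpha < 1 /\
    lebesgue_measure (approx_set A psi alpha) = 1%E].

(* The quotient at N = 0 is 0 and is irrelevant to the limit inferior. *)
Definition positive_lower_density A : Prop :=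
  (0 < limn_einf (fun N =>
    ((\sum_(1 <= n < N.+1) (n \in A))%N%:R / N%:R : R)%:E))%E.

Definition roots_of_unity (m : nat) : set R[i] := [set z | z ^+ m = 1].

Definition multiplicative_fun (f : nat -> R[i]) : Prop :=
  f 1%N = 1 /\
  forall n n', posN n -> posN n' -> coprime n n' -> f (n * n')%N = f n * f n'.

End Kurzweil.

Arguments BAD R : clear implicits.
Arguments divergent_decreasing R : clear implicits.
Arguments roots_of_unity R m : clear implicits.

Definition moebius (n : nat) : int :=
  if has (fun p => p ^ 2 %| n)%N (primes n) then 0
  else (-1) ^+ size (primes n).

Definition omega (n : nat) : nat := size (primes n).

Definition Omega (n : nat) : nat := (\sum_(p <- primes n) logn p n)%N.

(* Main.v *)
Require Import Defs.
From HB Require Import structures.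
From mathcomp Require Import all_boot all_order all_algebra.
From mathcomp Require Import all_classical all_reals all_analysis.
From mathcomp Require Import complex measurable_realfun ring lra zify.

(** For [alpha] that is not badly approximable there are denominators [q] with
    [q * dist_int (q * alpha)] arbitrarily small, so that long initial segments of
    the orbit [n alpha] stay close to [q] points of the circle. A decreasing [psi]
    which is constant on long blocks, adapted to a sequence of such denominators,
    has a divergent sum although the union of all its arcs has measure less than
    [1] ([kurzweil_sub_BAD]).

    For badly approximable [alpha], let [F] be the set of points that avoid all
    arcs of radius [psi n] around [- (n alpha)] for [n] in [A] with [J <= n]; it is
    closed, and a point outside [T_A (psi, alpha)] lies in such a set for some [J].
    If [F] had positive measure, take a Lipschitz bump [phi] around [F], and let
    [g] count the arcs with index up to [N] through a given point. Three facts
    contradict each other as [N] grows ([avoiding_set_null]). First, [g] is at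
    most [J] on [F]. Secondly, the second moment of [g] is at most a constant
    times [S ^ 2], where [S] is the sum of the radii, because the multiples of
    [alpha] are well spaced ([second_moment]); hence [g] puts little mass on the
    thin rim where [phi] is positive outside [F]. Thirdly, the integral of
    [g * phi] is at least a positive multiple of [S], because [A] has positive
    lower density and the [n alpha] with [n] in [A] are equidistributed
    ([equidistribution_along], [abel_lower_bound]).

    Equidistribution along [A] is where multiplicativity enters, through the
    argument of Daboussi and Kátai ([katai_criterion]): by the inequality of Turán
    and Kubilius a sum over [A] can be rewritten as a bilinear sum over [n = p m]
    with [p] prime, and it is small if the correlations of [phi (p m alpha)] and
    [phi (q m alpha)] over [m] are small for distinct primes [p] and [q]. The
    argument applies whenever membership of [p m] in [A] is determined by the
    values at [p] and [m] of a function [f] with finitely many values. For a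
    Lipschitz function [phi] of mean zero the correlations do not vanish, as they
    do for exponentials, but they are of order [1 / q] for [p < q], and this
    suffices ([correlation_bound]).

    In the special cases, [f] is the indicator of the squarefree numbers, the
    residue modulo [m] of the number of prime factors, or the residue of [n]
    itself. The densities are elementary: the reciprocals of the squares of the
    primes add up to less than [1] ([squarefree_dense]), and multiplication by a
    new prime raises the number of prime factors by one, so that all residue
    classes have positive lower density ([additive_class_dense]). *)

Set Implicit Arguments.
Unset Strict Implicit.
Unset Printing Implicit Defensive.

Import Order.TTheory GRing.Theory Num.Theory.
Import numFieldNormedType.Exports.

Local Open Scope classical_set_scope.
Local Open Scope ring_scope.

(** * Distance to the nearest integer and badly approximable numbers *)

Section DistInt.
Variable R : realType.
Implicit Types (x y : R) (k : int).

Lemma dist_int_le_norm x k : dist_int x <= `|x - k%:~R|.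
Proof.
apply: inf_lbound; last by exists k.
by exists 0 => _ [j _ <-].
Qed.

Lemma dist_int_attained x : exists k, dist_int x = `|x - k%:~R|.
Proof.
set k := Num.floor x.
have h1 : k%:~R <= x := floor_le_tmp x.
have h2 : x < (k + 1)%:~R := floorD1_gt x.
suff [j hj] : exists j, forall i : int, `|x - j%:~R| <= `|x - i%:~R|.
  exists j; apply/le_anti; rewrite dist_int_le_norm /=.
  apply: lb_le_inf; first by exists `|x - 0%:~R|; exists 0.
  by move=> _ [i _ <-].
have bnd i : x - k%:~R <= `|x - i%:~R| \/ (k + 1)%:~R - x <= `|x - i%:~R|.
  have [ik|ki] := leP i k.
    left; rewrite (le_trans _ (ler_norm _))// lerD2l lerN2 ler_int//.
  right; rewrite distrC (le_trans _ (ler_norm _))// lerD2r ler_int; lia.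
have [hle|hle] := leP (x - k%:~R) ((k + 1)%:~R - x).
  exists k => i; rewrite ger0_norm ?subr_ge0//.
  by have [//|h] := bnd i; exact: (le_trans hle h).
exists (k + 1) => i; rewrite distrC ger0_norm ?subr_ge0//; last exact: ltW.
by have [h|//] := bnd i; exact: (le_trans (ltW hle) h).
Qed.

Lemma dist_int_ge0 x : 0 <= dist_int x.
Proof. by have [k ->] := dist_int_attained x. Qed.

Lemma dist_int_le_abs x : dist_int x <= `|x|.
Proof. by have := dist_int_le_norm x 0; rewrite subr0. Qed.

Lemma dist_intD x y : dist_int (x + y) <= dist_int x + dist_int y.
Proof.
have [k ->] := dist_int_attained x; have [l ->] := dist_int_attained y.
apply: (le_trans (dist_int_le_norm _ (k + l))); rewrite rmorphD/=.
by apply: le_trans (ler_normD _ _); rewrite opprD addrACA.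
Qed.

Lemma dist_intN x : dist_int (- x) = dist_int x.
Proof.
suff h y : dist_int (- y) <= dist_int y.
  by apply/le_anti; rewrite h/= -{1}(opprK x) h.
have [k ->] := dist_int_attained y.
apply: (le_trans (dist_int_le_norm _ (- k))).
by rewrite rmorphN/= -opprD normrN.
Qed.

Lemma dist_intB x y : dist_int (x - y) <= dist_int x + dist_int y.
Proof. by rewrite -(dist_intN y) dist_intD. Qed.

Lemma dist_int_intr k : dist_int (k%:~R : R) = 0.
Proof.
apply/le_anti; rewrite dist_int_ge0 andbT.
by have := dist_int_le_norm k%:~R k; rewrite subrr normr0.
Qed.

Lemma dist_intDz x k : dist_int (x + k%:~R) = dist_int x.
Proof.
apply/le_anti/andP; split.
  by rewrite (le_trans (dist_intD _ _))// dist_int_intr addr0.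
rewrite -{1}(addrK k%:~R x) (le_trans (dist_intB _ _))//.
by rewrite dist_int_intr addr0.
Qed.

Lemma dist_intMn (n : nat) x : dist_int (n%:R * x) <= n%:R * dist_int x.
Proof.
elim: n => [|n IH]; first by rewrite !mul0r (dist_int_intr 0).
rewrite -natr1 !mulrDl !mul1r (le_trans (dist_intD _ _))//.
by rewrite lerD2r.
Qed.

Lemma dist_int_le_dist x y : dist_int x - dist_int y <= dist_int (x - y).
Proof. by rewrite lerBlDr -{1}(subrK y x) dist_intD. Qed.

Lemma limn_einf_gt0P (u : nat -> R) :
  (0 < limn_einf (fun n => (u n)%:E))%E <->
  exists2 c : R, 0 < c & exists n0, forall n, (n0 <= n)%N -> c <= u n.
Proof.
rewrite limn_einf_lim (cvg_lim _ (@cvg_einfs_sup _ _))//; split.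
  move=> /ereal_sup_gt[_ [n _ <-]].
  rewrite /einfs /= => h.
  set I := ereal_inf _ in h.
  have hI (k : nat) : (n <= k)%N -> (I <= (u k)%:E)%E.
    by move=> nk; apply: ereal_inf_lbound; exists k.
  have := hI n (leqnn n).
  case: I h hI => [r| |]//=; rewrite ?lte_fin => r0 hr _.
  by exists r => //; exists n => k /hr; rewrite lee_fin.
move=> [c c0 [n0 h]].
apply: (@lt_le_trans _ _ c%:E); first by rewrite lte_fin.
apply: (@le_trans _ _ (einfs (fun n => (u n)%:E) n0)); last first.
  by apply: ereal_sup_ubound; exists n0.
by apply: le_ereal_inf_tmp => _ [k /= nk <-]; rewrite lee_fin h.
Qed.

Definition badly_approximable (alpha : R) :=
  exists2 c : R, 0 < c &
    forall n, (0 < n)%N -> c <= n%:R * dist_int (n%:R * alpha).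

(** Replacing [n] by a multiple that lies beyond the exceptional range of the
    limit inferior costs only a constant factor, so the constant can be made
    uniform over all [n]. *)
Lemma BADP alpha :
  BAD R alpha <-> 0 <= alpha < 1 /\ badly_approximable alpha.
Proof.
rewrite /BAD/=; split=> -[-> h]; split=> //.
  have [c c0 [n0 hn0]] := (limn_einf_gt0P _).1 h.
  have n1 : 0 < n0.+1%:R ^+ 2 :> R by rewrite exprn_gt0// ltr0n.
  exists (c / n0.+1%:R ^+ 2) => [|n n_gt0]; first by rewrite divr_gt0.
  rewrite ler_pdivrMr//.
  have := hn0 (n0.+1 * n)%N.
  have -> : (n0 <= n0.+1 * n)%N by nia.
  move=> /(_ isT)/le_trans; apply.
  have key := dist_intMn n0.+1 (n%:R * alpha).
  rewrite mulrA -natrM in key.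
  apply: (le_trans (ler_wpM2l (ler0n _ _) key)).
  by rewrite le_eqVlt; apply/orP; left; apply/eqP; rewrite natrM; ring.
apply/limn_einf_gt0P; have [c c0 hc] := h; exists c => //.
by exists 1%N.
Qed.

Lemma badly_approximableN alpha :
  badly_approximable alpha -> badly_approximable (- alpha).
Proof.
by move=> [c c0 h]; exists c => // n /h; rewrite [_ * - alpha]mulrN dist_intN.
Qed.

End DistInt.

(** * Density of the multiples of a badly approximable number *)

Section Kronecker.
Variable R : realType.
Implicit Types (x y alpha eta : R).
Local Opaque dist_int.

Lemma badly_approximable_gt0 alpha n :
  badly_approximable alpha -> (0 < n)%N -> 0 < dist_int (n%:R * alpha).
Proof.
move=> [c c0 h] n0; have := lt_le_trans c0 (h n n0).
by rewrite pmulr_rgt0 ?ltr0n.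
Qed.

(** Pigeonhole principle: two of [N + 1] fractional parts share one of the [N]
    boxes of width [1 / N]. *)
Lemma exists_small_multiple alpha eta : 0 < eta ->
  exists2 t, (0 < t)%N & dist_int (t%:R * alpha) < eta.
Proof.
move=> eta0; set N := (Num.trunc eta^-1).+1.
have N0 : 0 < N%:R :> R by rewrite ltr0n.
have hN : N%:R^-1 < eta.
  rewrite invf_plt ?posrE// truncnS_gt//.
pose fr (i : nat) : R := i%:R * alpha - (Num.floor (i%:R * alpha))%:~R.
have fr01 i : 0 <= fr i < 1.
  rewrite /fr subr_ge0 floor_le_tmp ltrBlDr addrC.
  by have := floorD1_gt (i%:R * alpha); rewrite rmorphD.
have frN i : (Num.trunc (N%:R * fr i) < N)%N.
  have /andP[f0 f1] := fr01 i.
  rewrite -(ltr_nat R) (@le_lt_trans _ _ (N%:R * fr i))//.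
    by rewrite truncn_le mulr_ge0// ltW.
  by rewrite gtr_pMr.
have bracket i : (Num.trunc (N%:R * fr i))%:R <= N%:R * fr i /\
    N%:R * fr i < (Num.trunc (N%:R * fr i)).+1%:R.
  have /andP[f0 _] := fr01 i.
  by rewrite truncn_le truncnS_gt mulr_ge0// ltW.
pose F (i : 'I_N.+1) : 'I_N := Ordinal (frN i).
have [i [j [ij Fij]]] : exists i j : 'I_N.+1, (i < j)%N /\ F i = F j.
  have /injectivePn[i [j ij Fij]] : ~~ injectiveb F.
    by apply/negP => /injectiveP/leq_card; rewrite !card_ord ltnn.
  have [lt|lt|/val_inj eq] := ltngtP i j.
  - by exists i, j.
  - by exists j, i.
  - by rewrite eq eqxx in ij.
exists (j - i)%N; first by rewrite subn_gt0.
apply: le_lt_trans hN.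
rewrite natrB ?(ltnW ij)// mulrBl.
set k := Num.floor (j%:R * alpha) - Num.floor (i%:R * alpha).
apply: (le_trans (dist_int_le_norm _ k)).
have -> : j%:R * alpha - i%:R * alpha - k%:~R = fr j - fr i.
  by rewrite /fr /k rmorphB/=; ring.
have [i1 i2] := bracket i.
have [j1 j2] := bracket j.
have /(congr1 val)/= e := Fij; rewrite -e -natr1 in j1 j2; rewrite -natr1 in i2.
rewrite -(ler_pM2l N0) mulfV ?gt_eqF// -[X in X * _]ger0_norm ?ltW// -normrM.
by rewrite ltr_norml; lra.
Qed.

Lemma multiples_dense (theta x : R) : 0 < theta ->
  exists2 n, (0 < n)%N & dist_int (n%:R * theta - x) <= theta.
Proof.
move=> t0; set k := Num.ceil (theta - x).
have hk : theta <= x + k%:~R by rewrite -lerBlDl real_ceil_ge ?num_real.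
exists (Num.trunc ((x + k%:~R) / theta)).
  by rewrite truncn_gt0 ler_pdivlMr// mul1r.
set n := Num.trunc _.
have h0 : 0 <= (x + k%:~R) / theta.
  by rewrite divr_ge0 ?ltW// (lt_le_trans t0).
have : n%:R <= (x + k%:~R) / theta by rewrite truncn_le.
rewrite ler_pdivlMr// => h1.
have := truncnS_gt ((x + k%:~R) / theta).
rewrite -/n ltr_pdivrMr// -natr1 mulrDl mul1r => h2.
apply: (le_trans (dist_int_le_norm _ k)).
by rewrite ler_norml; lra.
Qed.

(** A small multiple of [alpha] is not an integer, because [alpha] is badly
    approximable; its own multiples then form a fine net of the circle. *)
Lemma kronecker alpha x eta : badly_approximable alpha -> 0 < eta ->
  exists2 t, (0 < t)%N & dist_int (t%:R * alpha - x) <= eta.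
Proof.
move=> bad eta0; have [t t0 ht] := exists_small_multiple alpha eta0.
have := badly_approximable_gt0 bad t0.
have [k hk] := dist_int_attained (t%:R * alpha).
rewrite hk in ht * => n0.
set th := t%:R * alpha - k%:~R in ht n0.
(* A negative step [th] walks towards [x] as the step [- th] walks towards [- x]. *)
have [n n1 hn] := multiples_dense (if 0 < th then x else - x) n0.
exists (n * t)%N; first by rewrite muln_gt0 n1.
apply: (le_trans _ (ltW ht)); apply: (le_trans _ hn).
have e : n%:R * th = (n * t)%:R * alpha - (n%:Z * k)%:~R.
  by rewrite /th natrM rmorphM/=; ring.
have [tp|tn] := ltP 0 th.
  rewrite gtr0_norm// e -(dist_intDz _ (- (n%:Z * k))) rmorphN/=.
  by rewrite le_eqVlt; apply/orP; left; apply/eqP; congr dist_int; ring.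
rewrite ler0_norm// mulrN e -(dist_intDz _ (- (n%:Z * k))) rmorphN/=.
rewrite -dist_intN.
by rewrite le_eqVlt; apply/orP; left; apply/eqP; congr dist_int; ring.
Qed.

End Kronecker.

(** * Correlations of Lipschitz functions along dilated orbits *)

Section Correlation.
Variable R : realType.
Implicit Types (x y alpha eta s : R) (phi : R -> R).
Local Opaque dist_int.

(** Lipschitz for the distance of the circle, hence in particular periodic of
    period [1]. *)
Definition circle_lipschitz s phi :=
  forall x y, `|phi x - phi y| <= s * dist_int (x - y).

Lemma circle_lipschitz_periodic s phi x (k : int) :
  circle_lipschitz s phi -> phi (x + k%:~R) = phi x.
Proof.
move=> /(_ (x + k%:~R) x); rewrite [x + _]addrC addrK dist_int_intr mulr0.
by rewrite normr_le0 subr_eq0 => /eqP.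
Qed.

Lemma sum_shift_diff (h : nat -> R) (M t : nat) : (forall m, `|h m| <= 1) ->
  `|\sum_(1 <= m < M.+1) h (m + t)%N - \sum_(1 <= m < M.+1) h m| <= 2 * t%:R.
Proof.
move=> h1; elim: t => [|t IH].
  by rewrite mulr0; under eq_bigr do rewrite addn0; rewrite subrr normr0.
have -> : \sum_(1 <= m < M.+1) h (m + t.+1)%N =
    \sum_(1 <= m < M.+1) h (m + t)%N + (h (M.+1 + t)%N - h (1 + t)%N).
  elim: M {IH} => [|M IH]; first by rewrite !big_geq// subrr addr0.
  by rewrite !(@big_nat_recr _ _ _ M.+1)//= IH addnS -addSn; ring.
rewrite addrAC (le_trans (ler_normD _ _))// -[t.+1%:R]natr1 mulrDr lerD//.
rewrite mulr1 (le_trans (ler_normB _ _))//.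
have := h1 (M.+1 + t)%N; have := h1 (1 + t)%N; lra.
Qed.

Lemma coprime_inverse p q : (0 < p)%N -> coprime p q ->
  exists e l, (p * e = 1 + q * l)%N.
Proof.
move=> p0 /eqP pq; case: (egcdnP q p0) => km kn; rewrite pq => h _.
by exists km, kn; rewrite mulnC h addnC mulnC.
Qed.

(** Take [t] such that [t alpha] is close to [e / q] modulo [1], where [e]
    inverts [p] modulo [q]. Shifting [m] by the multiples [j t], for [j < q],
    moves [p m alpha] through a full set of [q]-division points of the circle
    while [q m alpha] hardly moves, so the average over these shifts is
    controlled by a Riemann sum of [phi] with [q] terms. *)
Lemma correlation_bound phi s alpha p q :
  badly_approximable alpha -> 0 < s -> (0 < p < q)%N -> coprime p q ->
  (forall x, `|phi x| <= 1) -> circle_lipschitz s phi ->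
  (forall x, `|\sum_(j < q) phi (x + j%:R / q%:R)| <= 2 * s) ->
  exists2 C, 0 <= C & forall M,
    `|\sum_(1 <= m < M.+1)
        phi ((p * m)%:R * alpha) * phi ((q * m)%:R * alpha)| <=
    3 * s / q%:R * M%:R + C.
Proof.
move=> bad s0 /andP[p0 pq] cop phi1 lip riem.
have q0 : (0 < q)%N by apply: leq_trans pq.
have qR : 0 < q%:R :> R by rewrite ltr0n.
have q3 : 0 < 2 * q%:R ^+ 3 :> R by rewrite mulr_gt0// exprn_gt0.
have [e [l el]] := coprime_inverse p0 cop.
have [t t0 ht] := kronecker (e%:R / q%:R) bad (divr_gt0 ltr01 q3).
set de := t%:R * alpha - e%:R / q%:R in ht.
pose h m := phi ((p * m)%:R * alpha) * phi ((q * m)%:R * alpha).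
have h1 m : `|h m| <= 1 by rewrite normrM mulr_ile1.
exists (q%:R * (2 * t%:R)) => [|M]; first by rewrite !mulr_ge0// ltW.
have avg m : `|\sum_(j < q) h (m + j * t)%N| <= 3 * s.
  set x := (p * m)%:R * alpha; set y := (q * m)%:R * alpha.
  have close (j : 'I_q) :
      `|h (m + j * t)%N - phi (x + j%:R / q%:R) * phi y| <= s / q%:R.
    have jq : j%:R <= q%:R :> R by rewrite ler_nat ltnW.
    have small (r : nat) : (r <= q)%N ->
        dist_int ((r * j)%:R * de) <= (2 * q%:R)^-1.
      move=> rq; apply: (le_trans (dist_intMn _ _)).
      apply: (le_trans (ler_wpM2l (ler0n _ _) ht)).
      have -> : (2 * q%:R)^-1 = q%:R * q%:R * (1 / (2 * q%:R ^+ 3)) :> R.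
        by field; rewrite gt_eqF.
      rewrite natrM; apply: ler_wpM2r; first by apply: ltW; apply: divr_gt0.
      by apply: ler_pM => //; rewrite ler_nat.
    have d1 : `|phi ((p * (m + j * t))%:R * alpha) - phi (x + j%:R / q%:R)| <=
        s * (2 * q%:R)^-1.
      apply: (le_trans (lip _ _)); rewrite ler_pM2l//.
      rewrite (_ : _ - _ = (p * j)%:R * de + (l * j)%:Z%:~R).
        by rewrite dist_intDz small// ltnW.
      have : (p * e)%:R = (1 + q * l)%:R :> R by rewrite el.
      rewrite natrM natrD natrM => el'.
      rewrite /de /x -pmulrn !natrM natrD natrM mulrBr !mulrDr !mulrDl.
      rewrite (_ : p%:R * j%:R * (e%:R / q%:R) = j%:R * (1%:R + q%:R * l%:R) / q%:R); last first.
        by rewrite -el'; ring.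
      by field; rewrite gt_eqF.
    have d2 : `|phi ((q * (m + j * t))%:R * alpha) - phi y| <=
        s * (2 * q%:R)^-1.
      apply: (le_trans (lip _ _)); rewrite ler_pM2l//.
      rewrite (_ : _ - _ = (q * j)%:R * de + (e * j)%:Z%:~R).
        by rewrite dist_intDz small.
      rewrite /de /y -pmulrn !natrM natrD natrM.
      by field; rewrite gt_eqF.
    rewrite /h.
    set a := phi _ in d1 *; set b := phi _ in d2 *.
    set a' := phi (x + _) in d1 *; set b' := phi y in d2 *.
    have -> : a * b - a' * b' = (a - a') * b + a' * (b - b') by ring.
    rewrite (le_trans (ler_normD _ _))// !normrM.
    have -> : s / q%:R = s * (2 * q%:R)^-1 + s * (2 * q%:R)^-1.
      by field; rewrite gt_eqF.
    apply: lerD.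
      by rewrite -[leRHS]mulr1; apply: ler_pM => //; exact: phi1.
    by rewrite -[leRHS]mul1r; apply: ler_pM => //; exact: phi1.
  have -> : \sum_(j < q) h (m + j * t)%N =
     \sum_(j < q) (h (m + j * t)%N - phi (x + j%:R / q%:R) * phi y) +
     (\sum_(j < q) phi (x + j%:R / q%:R)) * phi y.
    by rewrite big_split/= sumrN mulr_suml subrK.
  rewrite (le_trans (ler_normD _ _))//.
  have -> : 3 * s = s + 2 * s by ring.
  apply: lerD.
    apply: (le_trans (ler_norm_sum _ _ _)).
    apply: (le_trans (ler_sum _ (fun j _ => close j))).
    by rewrite sumr_const card_ord -[_ *+ _]mulr_natr divfK// gt_eqF.
  by rewrite normrM -[leRHS]mulr1; apply: ler_pM => //; exact: phi1.
set S := \sum_(1 <= m < M.+1) _.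
have key : `|q%:R * S - \sum_(1 <= m < M.+1) \sum_(j < q) h (m + j * t)%N| <=
    q%:R * (q%:R * (2 * t%:R)).
  rewrite exchange_big/=.
  have -> : q%:R * S = \sum_(j < q) S.
    by rewrite sumr_const card_ord -[RHS]mulr_natl.
  rewrite -sumrB (le_trans (ler_norm_sum _ _ _))//.
  have -> : q%:R * (q%:R * (2 * t%:R)) = \sum_(j < q) (q%:R * (2 * t%:R)) :> R.
    by rewrite sumr_const card_ord -[RHS]mulr_natl.
  apply: ler_sum => j _; rewrite distrC.
  apply: (le_trans (sum_shift_diff M (j * t) h1)).
  rewrite natrM mulrCA; apply: ler_wpM2r; first by rewrite mulr_ge0.
  by rewrite ler_nat ltnW.
have key2 : `|\sum_(1 <= m < M.+1) \sum_(j < q) h (m + j * t)%N| <=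
    3 * s * M%:R.
  apply: (le_trans (ler_norm_sum _ _ _)).
  apply: (le_trans (ler_sum _ (fun m _ => avg m))).
  by rewrite sumr_const_nat subn1/= -[leLHS]mulr_natr.
rewrite -(ler_pM2l qR) -[X in X * _]gtr0_norm// -normrM.
have -> : q%:R * (3 * s / q%:R * M%:R + q%:R * (2 * t%:R)) =
  3 * s * M%:R + q%:R * (q%:R * (2 * t%:R)) by field; rewrite gt_eqF.
move: key key2; rewrite !ler_norml; lra.
Qed.

End Correlation.

(** * Divergence of the sum of the reciprocals of the primes *)

Section PrimeReciprocals.
Variable R : realType.

Definition prime_recip_sum (W : nat) : R := \sum_(0 <= p < W | prime p) p%:R^-1.

Lemma sum_dvdn d N : (0 < d)%N ->
  (\sum_(1 <= n < N.+1) (d %| n)%N = N %/ d)%N.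
Proof.
move=> d0; elim: N => [|N IH]; first by rewrite big_geq// div0n.
by rewrite big_nat_recr//= IH divnS// addnC.
Qed.

Lemma sum_ltn m k : (\sum_(0 <= n < m) (n < k) = minn m k)%N.
Proof.
elim: m => [|m IH]; first by rewrite big_geq// min0n.
by rewrite big_nat_recr//= IH; case: ltnP; lia.
Qed.

Lemma sum_ltn_ler m k : \sum_(1 <= n < m) (n < k)%N%:R <= k%:R :> R.
Proof.
rewrite -natr_sum ler_nat (leq_trans _ (geq_minr m k))// -sum_ltn.
case: m => [|m]; first by rewrite big_geq.
by rewrite [leqRHS]big_nat_recl// big_add1 leq_addl.
Qed.

Lemma ler_divn (N d : nat) : (N %/ d)%:R <= N%:R / d%:R :> R.
Proof.
have [->|d0] := posnP d; first by rewrite divn0 invr0 mulr0.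
by rewrite ler_pdivlMr ?ltr0n// -natrM ler_nat leq_trunc_div.
Qed.

Definition smooth w n := all (fun p => p < w)%N (primes n).

(** A smooth number is determined by its exponent vector, and the exponents
    of a number up to [2 ^ t] are at most [t]. *)
Lemma count_smooth w t :
  (\sum_(1 <= n < (2 ^ t).+1) smooth w n <= t.+1 ^ w)%N.
Proof.
have -> : (\sum_(1 <= n < (2 ^ t).+1) smooth w n =
   #|[pred n : 'I_(2 ^ t).+1 | (0 < n)%N && smooth w n]|)%N.
  rewrite -sum1_card big_mkcond/= (big_nat_widenl _ 0)//= big_mkord.
  rewrite big_mkcond [RHS]big_mkcond/=; apply: eq_bigr => i _; rewrite inE/=.
  by case: (0 < i)%N => //=; case: smooth.
rewrite -[X in (_ <= X ^ _)%N](card_ord t.+1) -[X in (_ <= _ ^ X)%N](card_ord w) -card_ffun.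
pose F (n : 'I_(2 ^ t).+1) : {ffun 'I_w -> 'I_t.+1} :=
  [ffun p : 'I_w => inord (logn p n)].
rewrite -(card_in_imset (f := F)); first exact: max_card.
move=> m n; rewrite !inE => /andP[m0 ms] /andP[n0 ns] eF.
apply/val_inj/eqn_from_log => // p.
have bnd (k : 'I_(2 ^ t).+1) : (0 < k)%N -> (logn p k <= t)%N.
  move=> k0; have [pp|np] := boolP (prime p); last by rewrite lognE (negbTE np).
  rewrite -(@leq_exp2l 2)// (@leq_trans (p ^ logn p k))//.
    by case: (logn p k) => // e; rewrite leq_exp2r// prime_gt1.
  by rewrite (leq_trans (dvdn_leq _ (pfactor_dvdnn _ _)))// -ltnS.
have [pw|wp] := ltnP p w.
  have /(congr1 (fun f : {ffun 'I_w -> 'I_t.+1} => nat_of_ord (f (Ordinal pw)))) := eF.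
  by rewrite !ffunE/= !inordK// ltnS bnd.
have z (k : 'I_(2 ^ t).+1) : smooth w k -> logn p k = 0%N.
  move=> /allP sk; apply/eqP; rewrite -leqn0 leqNgt logn_gt0.
  by apply/negP => /sk; rewrite ltnNge wp.
by rewrite !z.
Qed.

Lemma power_lt_exp w : exists t, (0 < t)%N /\ (2 * t.+1 ^ w < 2 ^ t)%N.
Proof.
have h : (w.+4.+1 * w + 5 < 2 ^ w.+4)%N.
  elim: w => // w; rewrite [(2 ^ w.+1.+4)%N]expnS; move: (2 ^ w.+4)%N => E; nia.
exists (2 ^ w.+4)%N; split; first by rewrite expn_gt0.
apply: (@leq_ltn_trans (2 ^ (w.+4.+1 * w + 1))%N); last by rewrite ltn_exp2l//; lia.
rewrite [(2 ^ (_ + 1))%N]expnD mulnC leq_mul2r/= expnM.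
by case: w {h} => [|w] //; rewrite leq_exp2r// ltn_exp2l.
Qed.

Lemma count_by_large_primes w N :
  (N <= \sum_(1 <= n < N.+1) smooth w n +
        \sum_(w <= p < N.+1 | prime p) N %/ p)%N.
Proof.
have -> : (\sum_(w <= p < N.+1 | prime p) N %/ p =
  \sum_(1 <= n < N.+1) \sum_(w <= p < N.+1 | prime p) (p %| n))%N.
  rewrite [RHS]exchange_big/=; apply: eq_bigr => p pp.
  by rewrite sum_dvdn ?prime_gt0.
rewrite -big_split/= -[X in (X <= _)%N]muln1 -[X in (X * _)%N]subn0 -subSS.
rewrite -sum_nat_const_nat big_nat_cond [leqRHS]big_nat_cond.
apply: leq_sum => n; rewrite andbT => /andP[n0 nN].
have [//|/allPn[p pn pw]] := boolP (smooth w n); rewrite add0n.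
move: pn; rewrite mem_primes => /and3P[pp _ pn].
rewrite -leqNgt in pw.
rewrite big_mkcond (bigD1_seq p) ?iota_uniq//=; last first.
  by rewrite mem_index_iota pw (leq_trans _ nN)// ltnS dvdn_leq.
by rewrite pp pn.
Qed.

(** Erdős's argument: if the tail of the series beyond [w] were at most [1 / 2],
    at most half of the numbers up to [2 ^ t] would have a prime factor
    at least [w], while at most [(t + 1) ^ w] of them have none. *)
Lemma prime_recip_sum_unbounded (B : R) : exists W, B <= prime_recip_sum W.
Proof.
apply: contrapT => /forallNP hB.
have lt W : prime_recip_sum W < B by rewrite ltNge; apply/negP/hB.
have [w hw] : exists w, forall W, prime_recip_sum W <= prime_recip_sum w + 2^-1.
  have hs : has_sup (range prime_recip_sum).
    split; first by exists (prime_recip_sum 0); exists 0%N.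
    by exists B => _ [W _ <-]; apply: ltW.
  (* A partial sum within [1 / 2] of the supremum leaves a tail of at most [1 / 2]. *)
  have h2 : 0 < 2^-1 :> R by [].
  have [_ [w _ <-] hw] := sup_adherent h2 hs.
  exists w => W; rewrite -lerBlDr.
  apply: le_trans (ltW hw); rewrite lerD2r.
  by apply: sup_upper_bound => //; exists W.
have [t [t0 ht]] := power_lt_exp w.
have wN : (w <= (2 ^ t).+1)%N.
  apply: leqW; apply: (leq_trans _ (ltnW ht)).
  apply: (@leq_trans (t.+1 ^ w)%N); last by rewrite leq_pmull.
  by rewrite ltnW// ltn_expl.
have := count_by_large_primes w (2 ^ t).
have := count_smooth w t; set a := (\sum_(1 <= n < _) _)%N => ha hb.
have hc : (\sum_(w <= p < (2 ^ t).+1 | prime p) 2 ^ t %/ p)%N%:R <=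
    (2 ^ t)%:R * 2^-1 :> R.
  rewrite natr_sum.
  apply: (@le_trans _ _ (\sum_(w <= p < (2 ^ t).+1 | prime p) ((2 ^ t)%:R * p%:R^-1))).
    by apply: ler_sum => p _; apply: ler_divn.
  rewrite -mulr_sumr ler_wpM2l//.
  have := hw (2 ^ t).+1; rewrite /prime_recip_sum.
  by rewrite (@big_cat_nat _ _ _ w 0 (2 ^ t).+1)//= lerD2l.
have : (2 ^ t)%:R <= a%:R + (2 ^ t)%:R * 2^-1 :> R.
  apply: (@le_trans _ _ (a + \sum_(w <= p < (2 ^ t).+1 | prime p) 2 ^ t %/ p)%N%:R).
    by rewrite ler_nat.
  by rewrite natrD lerD2l.
have : (2 * a)%:R < (2 ^ t)%:R :> R.
  by rewrite ltr_nat (leq_ltn_trans _ ht)// leq_mul2l.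
rewrite natrM; move: (2 ^ t)%:R a%:R => x y; lra.
Qed.

(** The prime [2] contributes [1 / 4], and the integers from [3] on contribute
    at most [1 / 2] by telescoping. That the total stays below [1] is what makes
    the squarefree numbers dense. *)
Lemma prime_sq_recip_sum (W : nat) :
  \sum_(0 <= p < W | prime p) (p ^ 2)%:R^-1 <= 3 / 4 :> R.
Proof.
have h n : \sum_(0 <= p < n.+3 | prime p) (p ^ 2)%:R^-1 <= 3 / 4 - n.+2%:R^-1 :> R.
  elim: n => [|n IH].
    by rewrite big_mkcond !big_nat_recr//= big_geq// !add0r natrX; lra.
  rewrite big_mkcond big_nat_recr//= -big_mkcond/=.
  apply: (@le_trans _ _ (3 / 4 - n.+2%:R^-1 + (n.+3 ^ 2)%:R^-1)).
    by rewrite lerD//; case: ifP => // _; rewrite invr_ge0.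
  have n1 : 0 < n.+2%:R :> R by [].
  rewrite -subr_ge0 natrX -[n.+3%:R]natr1.
  set x := n.+2%:R in n1 *.
  have -> : 3 / 4 - (x + 1)^-1 - (3 / 4 - x^-1 + (x + 1) ^- 2) =
      (x * (x + 1) ^+ 2)^-1 :> R.
    by field; rewrite !gt_eqF//; lra.
  by rewrite invr_ge0 mulr_ge0 ?exprn_ge0//; lra.
apply: (le_trans _ (le_trans (h W) _)); last by rewrite gerBl invr_ge0.
rewrite (@big_cat_nat _ _ _ W 0 W.+3)//=; last by lia.
by rewrite lerDl sumr_ge0// => p _; rewrite invr_ge0.
Qed.

End PrimeReciprocals.

(** * The inequality of Turán and Kubilius *)

Section Katai.
Variable R : realType.
Local Notation prime_sum W F := (\sum_(0 <= p < W | prime p) F p).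

(** The inequality of arithmetic and geometric means, in the form that stands
    in for the Cauchy-Schwarz inequality once [T] is optimised. *)
Lemma norm_le_sqr (T x : R) : 0 < T -> `|x| <= x ^+ 2 / (2 * T) + T / 2.
Proof.
move=> T0; rewrite -[x ^+ 2]real_normK ?num_real// -subr_ge0.
have -> : `|x| ^+ 2 / (2 * T) + T / 2 - `|x| = (`|x| - T) ^+ 2 / (2 * T).
  by field; rewrite gt_eqF.
by rewrite divr_ge0 ?sqr_ge0// mulr_ge0// ltW.
Qed.

Lemma sum_multiples (F : nat -> R) p N : (0 < p)%N ->
  \sum_(1 <= n < N.+1) (p %| n)%:R * F n =
  \sum_(1 <= m < N.+1) (p * m <= N)%N%:R * F (p * m)%N.
Proof.
move=> p0.
have -> : \sum_(1 <= m < N.+1) (p * m <= N)%N%:R * F (p * m)%N =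
    \sum_(1 <= m < N.+1) \sum_(1 <= n < N.+1 | n == (p * m)%N) F n.
  apply: eq_big_nat => m /andP[m0 _].
  rewrite big_nat1_eq muln_gt0 p0 m0/= ltnS.
  by case: (_ <= _)%N; rewrite ?mul1r ?mul0r.
under [RHS]eq_bigr do rewrite big_mkcond.
rewrite exchange_big; apply: eq_big_nat => n /andP[n0 nN] /=.
have [/dvdnP[k nk]|pn] := boolP (p %| n)%N.
  have e m : (n == p * m)%N = (m == k) by rewrite nk mulnC eqn_pmul2l// eq_sym.
  under eq_bigr do rewrite e.
  rewrite -big_mkcond big_nat1_eq mul1r.
  by have -> : (0 < k < N.+1)%N by rewrite nk in n0 nN; nia.
rewrite mul0r big1// => m _; case: eqP => // e.
by rewrite e dvdn_mulr in pn.
Qed.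

Lemma sum_dvdn_ler d N : (0 < d)%N ->
  \sum_(1 <= n < N.+1) (d %| n)%:R <= N%:R / d%:R :> R.
Proof. by move=> d0; rewrite -natr_sum sum_dvdn// ler_divn. Qed.

Lemma sum_cofactors_ler p N : (0 < p)%N ->
  \sum_(1 <= m < N.+1) (p * m <= N)%N%:R <= N%:R / p%:R :> R.
Proof.
move=> p0; rewrite (le_trans _ (sum_dvdn_ler N p0))//.
under [leRHS]eq_bigr do rewrite -[_%:R]mulr1.
rewrite (sum_multiples (fun=> 1))//.
by under [leRHS]eq_bigr do rewrite mulr1.
Qed.

(** Two distinct primes divide [n] almost independently, with frequency
    [1 / (p q)]; hence only the diagonal terms contribute to the variance of the
    number of prime divisors of [n] below [W]. *)
Lemma turan_kubilius W N (L := prime_recip_sum R W) :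
  \sum_(1 <= n < N.+1) (prime_sum W (fun p => (p %| n)%:R) - L) ^+ 2 <=
  N%:R * L + 2 * L * W%:R.
Proof.
pose w n : R := prime_sum W (fun p => (p %| n)%:R).
have L0 : 0 <= L by apply: sumr_ge0 => p _; rewrite invr_ge0.
have NL : prime_sum W (fun p => N%:R / p%:R) = N%:R * L.
  by rewrite /L /prime_recip_sum mulr_sumr.
have hw : N%:R * L - W%:R <= \sum_(1 <= n < N.+1) w n.
  rewrite exchange_big/=.
  have : prime_sum W (fun p => N%:R / p%:R - 1 : R) <=
         prime_sum W (fun p => \sum_(1 <= n < N.+1) (p %| n)%:R : R).
    apply: ler_sum => p /prime_gt0 p0.
    rewrite -natr_sum sum_dvdn// lerBlDr ler_pdivrMr ?ltr0n// natr1 -natrM.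
    by rewrite ler_nat ltnW// ltn_ceil.
  apply: le_trans; rewrite sumrB NL lerD2l lerN2.
  rewrite (@le_trans _ _ (\sum_(0 <= p < W) 1))//; last first.
    by rewrite sumr_const_nat subn0.
  by rewrite big_mkcond ler_sum// => p _; case: ifP.
have hw2 : \sum_(1 <= n < N.+1) w n ^+ 2 <= N%:R * L ^+ 2 + N%:R * L.
  have -> : \sum_(1 <= n < N.+1) w n ^+ 2 = prime_sum W (fun p =>
      prime_sum W (fun q => \sum_(1 <= n < N.+1) (p %| n)%:R * (q %| n)%:R)).
    under eq_bigr do rewrite expr2 /w mulr_suml.
    rewrite exchange_big/=; apply: eq_bigr => p _.
    under eq_bigr do rewrite mulr_sumr.
    by rewrite exchange_big.
  apply: (@le_trans _ _ (prime_sum W (fun p => prime_sum W (fun q =>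
      N%:R * (p%:R^-1 * q%:R^-1) + (p == q)%:R * (N%:R / p%:R))))).
    apply: ler_sum => p pp; apply: ler_sum => q pq.
    have p0 := prime_gt0 pp; have q0 := prime_gt0 pq.
    have [<-|neq] := eqVneq p q.
      rewrite mul1r (@le_trans _ _ (N%:R / p%:R))//.
        apply: le_trans (sum_dvdn_ler N p0); apply: ler_sum => n _.
        by rewrite -natrM mulnb andbb.
      by rewrite lerDr !mulr_ge0// invr_ge0.
    rewrite mul0r addr0 -invfM -natrM.
    have pq0 : (0 < p * q)%N by rewrite muln_gt0 p0.
    apply: le_trans (sum_dvdn_ler N pq0); apply: ler_sum => n _.
    rewrite -natrM mulnb Gauss_dvd//.
    by rewrite prime_coprime// dvdn_prime2.
  under eq_bigr do rewrite big_split/=.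
  rewrite big_split/= lerD//.
    rewrite expr2 {2}/L /prime_recip_sum mulrA mulr_sumr ler_sum// => p _.
    by rewrite -!mulr_sumr mulrA (mulrAC _ L).
  rewrite -NL ler_sum// => p pp.
  rewrite -mulr_suml ler_piMl ?divr_ge0//.
  rewrite big_mkcond (@le_trans _ _ (\sum_(0 <= q < W | q == p) 1))//.
    rewrite [leRHS]big_mkcond ler_sum// => q _; rewrite eq_sym.
    by case: eqP; case: ifP.
  by rewrite big_nat1_eq; case: ifP.
have -> : \sum_(1 <= n < N.+1) (w n - L) ^+ 2 =
    \sum_(1 <= n < N.+1) w n ^+ 2 - 2 * L * \sum_(1 <= n < N.+1) w n
    + N%:R * L ^+ 2.
  rewrite mulr_sumr -sumrB.
  have -> : N%:R * L ^+ 2 = \sum_(1 <= n < N.+1) L ^+ 2.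
    by rewrite sumr_const_nat subn1/= -[RHS]mulr_natl.
  by rewrite -big_split/=; apply: eq_bigr => n _; ring.
have := ler_wpM2l (mulr_ge0 (ler0n R 2) L0) hw.
by move: hw2; rewrite expr2; lra.
Qed.

End Katai.

(** * Kátai's criterion *)

Section KataiCriterion.
Variable R : realType.
Local Notation prime_sum W F := (\sum_(0 <= p < W | prime p) F p).
Variables (V : finType) (f : nat -> V) (A : pred nat) (G : V -> V -> bool).
Hypothesis A_mul : forall p m, prime p -> (0 < m)%N -> ~~ (p %| m)%N ->
  A (p * m)%N = G (f p) (f m).
Variables (u : nat -> R) (kappa : R).
Hypothesis u1 : forall n, `|u n| <= 1.
Hypothesis kappa0 : 0 <= kappa.
Variable C : nat -> nat -> R.
Hypothesis C0 : forall p q, 0 <= C p q.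
Hypothesis u_corr : forall p q, prime p -> prime q -> (p < q)%N -> forall M,
  `|\sum_(1 <= m < M.+1) u (p * m)%N * u (q * m)%N| <=
  kappa / q%:R * M%:R + C p q.

(* The sum over primes that remains at [m] when the value of [f m] is frozen
   to [v]. *)
Let twisted N W v m : R :=
  prime_sum W (fun p => (p * m <= N)%N%:R * (G (f p) v)%:R * u (p * m)%N).

Lemma sum_cofactors (F : nat -> R) q N : (0 < q)%N ->
  \sum_(1 <= m < N.+1) (q * m <= N)%N%:R * F m =
  \sum_(1 <= m < (N %/ q).+1) F m.
Proof.
move=> q0; rewrite (@big_cat_nat _ _ _ (N %/ q).+1 1 N.+1)//=; last first.
  by rewrite ltnS leq_div.
rewrite [X in _ + X]big_nat_cond [X in _ + X]big1 ?addr0; last first.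
  by move=> m /andP[/andP[m1 _] _]; rewrite mulnC -leq_divRL// leqNgt m1 mul0r.
apply: eq_big_nat => m /andP[m0]; rewrite ltnS leq_divRL// mulnC => ->.
by rewrite mul1r.
Qed.

Lemma twisted_correlation p q N : prime p -> prime q -> (p < q)%N ->
  `|\sum_(1 <= m < N.+1) (p * m <= N)%N%:R * (q * m <= N)%N%:R *
     (u (p * m)%N * u (q * m)%N)| <= kappa * N%:R / (q ^ 2)%:R + C p q.
Proof.
move=> pp pq lt.
have -> : \sum_(1 <= m < N.+1) (p * m <= N)%N%:R * (q * m <= N)%N%:R *
     (u (p * m)%N * u (q * m)%N) =
  \sum_(1 <= m < (N %/ q).+1) u (p * m)%N * u (q * m)%N.
  rewrite -sum_cofactors ?prime_gt0//; apply: eq_bigr => m _; congr (_ * _).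
  rewrite -natrM mulnb; case: (leqP (q * m) N) => qm; last by rewrite andbF.
  by rewrite andbT (leq_trans _ qm)// leq_mul2r ltnW// orbT.
apply: (le_trans (u_corr pp pq lt _)); rewrite lerD2r.
have q0 : 0 < q%:R :> R by rewrite ltr0n prime_gt0.
have -> : kappa * N%:R / (q ^ 2)%:R = kappa / q%:R * (N%:R / q%:R).
  by rewrite natrX; field; rewrite gt_eqF.
by rewrite ler_wpM2l ?ler_divn// divr_ge0// ltW.
Qed.

(** The diagonal contributes at most [N L]. For [p < q] the correlation is at
    most [kappa N / q ^ 2] up to a constant, and there are at most [q] primes
    below [q], so all pairs together contribute at most [2 kappa N L]. *)
Lemma twisted_square W N v (L := prime_recip_sum R W) :
  \sum_(1 <= m < N.+1) twisted N W v m ^+ 2 <=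
  N%:R * L * (1 + 2 * kappa) +
  prime_sum W (fun p => prime_sum W (fun q => C p q + C q p)).
Proof.
pose S p q : R := \sum_(1 <= m < N.+1) (p * m <= N)%N%:R * (q * m <= N)%N%:R *
     (u (p * m)%N * u (q * m)%N).
have -> : \sum_(1 <= m < N.+1) twisted N W v m ^+ 2 =
  prime_sum W (fun p => prime_sum W (fun q =>
    (G (f p) v)%:R * (G (f q) v)%:R * S p q)).
  under eq_bigr do rewrite expr2 /twisted mulr_suml.
  rewrite exchange_big/=; apply: eq_bigr => p _.
  under eq_bigr do rewrite mulr_sumr.
  rewrite exchange_big/=; apply: eq_bigr => q _.
  by rewrite mulr_sumr; apply: eq_bigr => m _; ring.
pose tail p q : R := (p < q)%N%:R * (kappa * N%:R / (q ^ 2)%:R).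
have tail0 p q : 0 <= tail p q by rewrite !mulr_ge0// invr_ge0.
apply: (@le_trans _ _ (prime_sum W (fun p => prime_sum W (fun q =>
    (p == q)%:R * (N%:R / p%:R) + (tail p q + tail q p) + (C p q + C q p))))).
  apply: ler_sum => p pp; apply: ler_sum => q pq.
  have S0 : `|S p q| <= (p == q)%:R * (N%:R / p%:R) + (tail p q + tail q p) +
                        (C p q + C q p).
    have [lt|lt|<-] := ltngtP p q.
    - rewrite mul0r add0r; apply: (le_trans (twisted_correlation N pp pq lt)).
      rewrite [tail p q]/tail lt mul1r.
      by have := tail0 q p; have := C0 q p; lra.
    - have -> : S p q = S q p.
        by apply: eq_bigr => m _; rewrite mulrC [u _ * _]mulrC mulrC [_ * (_)%:R]mulrC.
      rewrite mul0r add0r; apply: (le_trans (twisted_correlation N pq pp lt)).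
      rewrite [tail q p]/tail lt mul1r.
      by have := tail0 p q; have := C0 p q; lra.
    rewrite mul1r -addrA (@le_trans _ _ (N%:R / p%:R))//; last first.
      by rewrite lerDl !addr_ge0.
    apply: (le_trans (ler_norm_sum _ _ _)).
    apply: le_trans (sum_cofactors_ler _ N (prime_gt0 pp)).
    apply: ler_sum => m _.
    case: (_ <= _)%N; rewrite ?mul0r ?normr0// !mul1r normrM.
    by rewrite mulr_ile1.
  apply: le_trans S0; apply: (le_trans (ler_norm _)); rewrite normrM.
  rewrite ler_piMl// -natrM normr_nat -[leRHS]/(1%:R) ler_nat.
  by do 2 case: (G _ _).
have Ediag : prime_sum W (fun p => prime_sum W (fun q =>
    (p == q)%:R * (N%:R / p%:R) : R)) <= N%:R * L.
  rewrite /L /prime_recip_sum mulr_sumr ler_sum// => p pp.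
  rewrite -mulr_suml ler_piMl ?divr_ge0//.
  rewrite big_mkcond (@le_trans _ _ (\sum_(0 <= q < W | q == p) 1))//.
    rewrite [leRHS]big_mkcond ler_sum// => q _; rewrite eq_sym.
    by case: eqP; case: ifP.
  by rewrite big_nat1_eq; case: ifP.
have Etail' : prime_sum W (fun p => prime_sum W (fun q => tail q p)) <=
    kappa * (N%:R * L).
  rewrite /L /prime_recip_sum !mulr_sumr ler_sum// => p pp.
  rewrite -mulr_suml.
  have p0 : 0 < p%:R :> R by rewrite ltr0n prime_gt0.
  have h : prime_sum W (fun q => (q < p)%N%:R : R) <= p%:R.
    rewrite big_mkcond (@le_trans _ _ (\sum_(0 <= q < W) (q < p)%N%:R))//.
      by rewrite ler_sum// => q _; case: ifP.
    by rewrite -natr_sum sum_ltn ler_nat geq_minr.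
  apply: (@le_trans _ _ (p%:R * (kappa * N%:R / (p ^ 2)%:R))).
    by rewrite ler_wpM2r// divr_ge0// mulr_ge0.
  rewrite le_eqVlt; apply/orP; left; apply/eqP; rewrite natrX.
  by field; rewrite gt_eqF.
have Etail : prime_sum W (fun p => prime_sum W (fun q => tail p q)) <=
    kappa * (N%:R * L) by rewrite exchange_big.
have -> : prime_sum W (fun p => prime_sum W (fun q =>
    (p == q)%:R * (N%:R / p%:R) + (tail p q + tail q p) + (C p q + C q p))) =
  prime_sum W (fun p => prime_sum W (fun q => (p == q)%:R * (N%:R / p%:R))) +
  (prime_sum W (fun p => prime_sum W (fun q => tail p q)) +
   prime_sum W (fun p => prime_sum W (fun q => tail q p))) +
  prime_sum W (fun p => prime_sum W (fun q => C p q + C q p)).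
  by rewrite -!big_split/=; apply: eq_bigr => p _; rewrite -!big_split.
rewrite lerD2r; lra.
Qed.

(** The number of prime divisors of [n] below [W] is nearly the constant [L].
    Weighting the sum by it, and writing [n = p m], makes the sum bilinear in
    [p] and [m]: membership of [n] in [A] depends on [f p] and [f m] only, unless
    [p] divides [m], which happens for at most [N / p ^ 2] of the numbers. For
    each value [v] of [f m], a mean square over [m] removes [A] altogether and
    leaves the correlations of [u]. *)
Lemma katai_quantitative W N T (L := prime_recip_sum R W) :
  0 < T -> T ^+ 2 = L ->
  L * `|\sum_(1 <= n < N.+1) (A n)%:R * u n| <=
  N%:R * (T + 1 + #|V|%:R * (T * (1 + kappa))) +
  (T * W%:R + #|V|%:R / (2 * T) *
     prime_sum W (fun p => prime_sum W (fun q => C p q + C q p))).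
Proof.
move=> T0 TL; pose w n : R := prime_sum W (fun p => (p %| n)%:R).
pose a n : R := (A n)%:R.
have a1 n : `|a n| <= 1 by rewrite normr_nat /a; case: (A n).
have hw : \sum_(1 <= n < N.+1) `|w n - L| <= N%:R * T + T * W%:R.
  have h n : `|w n - L| <= (w n - L) ^+ 2 / (2 * T) + T / 2.
    exact: norm_le_sqr.
  apply: (le_trans (ler_sum _ (fun n _ => h n))).
  rewrite big_split/= -mulr_suml sumr_const_nat subn1/= -[_ *+ N]mulr_natl.
  have := turan_kubilius R W N; rewrite -/L -TL => tk.
  apply: (@le_trans _ _ ((N%:R * T ^+ 2 + 2 * T ^+ 2 * W%:R) / (2 * T) + N%:R * (T / 2))).
    by rewrite lerD2r ler_pM2r// invr_gt0 mulr_gt0.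
  rewrite le_eqVlt; apply/orP; left; apply/eqP.
  by field; rewrite gt_eqF.
have hmain : `|\sum_(1 <= n < N.+1) a n * u n * w n| <=
    N%:R + \sum_(1 <= m < N.+1) \sum_v `|twisted N W v m|.
  have -> : \sum_(1 <= n < N.+1) a n * u n * w n =
      prime_sum W (fun p => \sum_(1 <= m < N.+1)
        (p * m <= N)%N%:R * ((a (p * m)%N - (G (f p) (f m))%:R) * u (p * m)%N)) +
      \sum_(1 <= m < N.+1) twisted N W (f m) m.
    under eq_bigr do rewrite /w mulr_sumr.
    rewrite exchange_big/= [X in _ = _ + X]exchange_big/= -big_split/=.
    apply: eq_bigr => p pp; rewrite -big_split/=.
    under eq_bigr do rewrite mulrC.
    rewrite (sum_multiples (fun n => a n * u n)) ?prime_gt0//.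
    by apply: eq_bigr => m _; ring.
  apply: (le_trans (ler_normD _ _)); apply: lerD; last first.
    apply: (le_trans (ler_norm_sum _ _ _)); apply: ler_sum => m _.
    by rewrite (bigD1 (f m))//= lerDl sumr_ge0.
  apply: (le_trans (ler_norm_sum _ _ _)).
  apply: (@le_trans _ _ (prime_sum W (fun p => N%:R / (p ^ 2)%:R))); last first.
    rewrite -mulr_sumr -[leRHS]mulr1 ler_wpM2l//.
    by apply: (le_trans (prime_sq_recip_sum R W)); lra.
  apply: ler_sum => p pp; have p0 := prime_gt0 pp.
  have p20 : (0 < p ^ 2)%N by rewrite expn_gt0 p0.
  apply: le_trans (sum_dvdn_ler _ N p20).
  apply: (@le_trans _ _ (\sum_(1 <= n < N.+1) (p %| n)%:R * (p ^ 2 %| n)%:R)); last first.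
    by apply: ler_sum => n _; rewrite -natrM ler_nat mulnb;
      case: (p %| n)%N; case: (_ %| n)%N.
  rewrite (sum_multiples (fun n => (p ^ 2 %| n)%:R))//.
  apply: (le_trans (ler_norm_sum _ _ _)).
  rewrite big_nat_cond [leRHS]big_nat_cond; apply: ler_sum => m.
  rewrite andbT => /andP[m0 _].
  rewrite normrM normr_nat ler_wpM2l// expnS expn1 dvdn_pmul2l//.
  have [pm|pm] := boolP (p %| m)%N.
    rewrite normrM mulr_ile1// /a.
    by case: (A _); case: (G _ _); rewrite ?subrr ?normr0 ?subr0 ?sub0r ?normrN ?normr1.
  by rewrite /a A_mul// subrr mul0r normr0.
have hcs : \sum_(1 <= m < N.+1) \sum_v `|twisted N W v m| <=
    #|V|%:R * ((N%:R * L * (1 + 2 * kappa) +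
      prime_sum W (fun p => prime_sum W (fun q => C p q + C q p))) / (2 * T) +
      N%:R * (T / 2)).
  rewrite exchange_big/=.
  rewrite [leRHS]mulr_natl -sumr_const ler_sum// => v _.
  have h m : `|twisted N W v m| <= twisted N W v m ^+ 2 / (2 * T) + T / 2.
    exact: norm_le_sqr.
  apply: (le_trans (ler_sum _ (fun m _ => h m))).
  rewrite big_split/= -mulr_suml sumr_const_nat subn1/= -[_ *+ N]mulr_natl.
  by rewrite lerD2r ler_pM2r ?twisted_square// invr_gt0 mulr_gt0.
have L0 : 0 <= L by rewrite -TL sqr_ge0.
rewrite -[X in X * _]ger0_norm// -normrM.
have -> : L * (\sum_(1 <= n < N.+1) (A n)%:R * u n) =
    \sum_(1 <= n < N.+1) a n * u n * w n -
    \sum_(1 <= n < N.+1) a n * u n * (w n - L).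
  by rewrite -sumrB mulr_sumr; apply: eq_bigr => n _; rewrite /a; ring.
apply: (le_trans (ler_normB _ _)).
have hlast : `|\sum_(1 <= n < N.+1) a n * u n * (w n - L)| <= N%:R * T + T * W%:R.
  apply: (le_trans (ler_norm_sum _ _ _)); apply: le_trans hw.
  apply: ler_sum => n _; rewrite normrM ler_piMl// normrM mulr_ile1//.
apply: (le_trans (lerD hmain hlast)).
apply: (le_trans (lerD (lerD (lexx _) hcs) (lexx _))).
rewrite -TL le_eqVlt; apply/orP; left; apply/eqP.
by field; rewrite gt_eqF.
Qed.

(** All terms of the quantitative bound are of order [T N] with [T ^ 2 = L], so
    dividing by [L], which is as large as desired, gives the claim. *)
Lemma katai_criterion (eps : R) : 0 < eps ->
  exists2 K, 0 <= K & forall N,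
    `|\sum_(1 <= n < N.+1) (A n)%:R * u n| <= eps * N%:R + K.
Proof.
move=> eps0; set D := 2 + #|V|%:R * (1 + kappa).
have D0 : 0 < D by rewrite ltr_pwDl// mulr_ge0// addr_ge0.
have [W hW] := prime_recip_sum_unbounded (Num.max 1 (D / eps) ^+ 2).
set L := prime_recip_sum R W in hW; set M := Num.max _ _ in hW.
have M1 : 1 <= M by rewrite le_max lexx.
have L1 : 1 <= L by apply: le_trans hW; rewrite expr_ge1// ltW// (lt_le_trans ltr01).
pose T := Num.sqrt L.
have TL : T ^+ 2 = L by rewrite sqr_sqrtr// (le_trans ler01).
have T0 : 0 < T by rewrite sqrtr_gt0 (lt_le_trans ltr01).
have MT : M <= T.
  have M0 : 0 <= M by apply: le_trans M1.
  by rewrite -(@ler_pXn2r _ 2)// ?nnegrE ?TL// ltW.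
have DT : D / eps <= T by apply: (le_trans _ MT); rewrite le_max lexx orbT.
set P : R := prime_sum W (fun p => prime_sum W (fun q => C p q + C q p)).
have P0 : 0 <= P by apply: sumr_ge0 => p _; apply: sumr_ge0 => q _; rewrite addr_ge0.
have VT : 0 <= #|V|%:R / (2 * T) by rewrite divr_ge0// mulr_ge0// ltW.
have K0 : 0 <= T * W%:R + #|V|%:R / (2 * T) * P.
  exact: (addr_ge0 (mulr_ge0 (ltW T0) (ler0n _ _)) (mulr_ge0 VT P0)).
exists (T * W%:R + #|V|%:R / (2 * T) * P) => // N.
have := katai_quantitative N T0 TL; rewrite -/L -/P.
move: (T * W%:R + _) K0 => K K0; set S := `|_| => h.
have T1 : 1 <= T by apply: (le_trans M1).
have h2 : L * S <= L * (eps * N%:R) + K.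
  apply: (le_trans h); rewrite lerD2r.
  have -> : L * (eps * N%:R) = N%:R * (L * eps) by ring.
  rewrite ler_wpM2l//.
  rewrite ler_pdivrMr// in DT.
  have h3 : T * D <= L * eps by rewrite -TL expr2 -mulrA ler_pM2l.
  apply: le_trans h3.
  have -> : T * D = T + T + #|V|%:R * (T * (1 + kappa)) by rewrite /D; ring.
  by rewrite lerD2r lerD2l.
have L0 : 0 < L by apply: lt_le_trans L1.
rewrite -(ler_pM2l L0) mulrDr (le_trans h2)// lerD2l.
by rewrite ler_peMl.
Qed.

End KataiCriterion.

(** * Arcs and integration on the circle *)

Section CircleMeasure.
Variable R : realType.
Implicit Types (x y z r s : R) (g h : R -> R) (S : set R).
Local Opaque dist_int.

Notation mu := (@lebesgue_measure R).
Notation D := (`[0%R, 1%R[%classic : set R).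

Definition circle_mean g : R := \int[mu]_(x in D) g x.

(** Closed under all the operations needed below and sufficient for
    integrability over the circle. *)
Definition bounded_measurable g :=
  measurable_fun setT g /\ exists M, forall x, `|g x| <= M.

Lemma circle_measure1 : mu D = 1%E.
Proof. by rewrite lebesgue_measure_itv/= lte_fin ltr01 sube0. Qed.

Lemma bounded_measurable_integrable g :
  bounded_measurable g -> mu.-integrable D (EFin \o g).
Proof.
move=> [mg [M hM]]; apply: measurable_bounded_integrable => //.
- by rewrite (_ : _ D = 1%E) ?ltry//; exact: circle_measure1.
- exact: measurable_funTS.
- exists M; split; first exact: num_real.
  by move=> M' MM' x _ /=; rewrite (le_trans (hM x))// ltW.
Qed.

Lemma bounded_measurableD g h : bounded_measurable g -> bounded_measurable h ->
  bounded_measurable (fun x => g x + h x).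
Proof.
move=> [mg [M hM]] [mh [M' hM']]; split; first exact: measurable_funD.
by exists (M + M') => x; rewrite (le_trans (ler_normD _ _))// lerD.
Qed.

Lemma bounded_measurableM g h : bounded_measurable g -> bounded_measurable h ->
  bounded_measurable (fun x => g x * h x).
Proof.
move=> [mg [M hM]] [mh [M' hM']]; split; first exact: measurable_funM.
by exists (M * M') => x; rewrite normrM ler_pM.
Qed.

Lemma bounded_measurable_cst r : bounded_measurable (fun=> r).
Proof. by split; [exact: measurable_cst|exists `|r|]. Qed.

Lemma bounded_measurableZ r g : bounded_measurable g ->
  bounded_measurable (fun x => r * g x).
Proof. exact/bounded_measurableM/bounded_measurable_cst. Qed.

Lemma bounded_measurable_indic S : measurable S -> bounded_measurable (\1_S).
Proof.
move=> mS; split; first exact: measurable_indic.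
by exists 1 => x; rewrite indicE normr_nat; case: (x \in S).
Qed.

Lemma bounded_measurable_sum (I : Type) (t : seq I) (P : pred I) (F : I -> R -> R) :
  (forall i, P i -> bounded_measurable (F i)) ->
  bounded_measurable (fun x => \sum_(i <- t | P i) F i x).
Proof.
move=> hF; elim: t => [|i t IH].
  rewrite (_ : (fun _ => _) = fun=> 0); first exact: bounded_measurable_cst.
  by apply/funext => x; rewrite big_nil.
have [Pi|nPi] := boolP (P i).
  rewrite (_ : (fun _ => _) = fun x => F i x + \sum_(j <- t | P j) F j x).
    by apply: bounded_measurableD => //; apply: hF.
  by apply/funext => x; rewrite big_cons Pi.
rewrite (_ : (fun _ => _) = fun x => \sum_(j <- t | P j) F j x)//.
by apply/funext => x; rewrite big_cons (negbTE nPi).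
Qed.

Lemma circle_meanD g h : bounded_measurable g -> bounded_measurable h ->
  circle_mean (fun x => g x + h x) = circle_mean g + circle_mean h.
Proof.
by move=> bg bh; apply: RintegralD => //; apply: bounded_measurable_integrable.
Qed.

Lemma circle_meanZ r g : bounded_measurable g ->
  circle_mean (fun x => r * g x) = r * circle_mean g.
Proof.
by move=> bg; apply: RintegralZl => //; apply: bounded_measurable_integrable.
Qed.

Lemma circle_mean_sum (I : Type) (t : seq I) (P : pred I) (F : I -> R -> R) :
  (forall i, P i -> bounded_measurable (F i)) ->
  circle_mean (fun x => \sum_(i <- t | P i) F i x) =
  \sum_(i <- t | P i) circle_mean (F i).
Proof.
move=> hF; elim: t => [|i t IH].
  rewrite big_nil (_ : (fun _ => _) = fun=> 0).
    by rewrite /circle_mean Rintegral_cst// mul0r.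
  by apply/funext => x; rewrite big_nil.
rewrite big_cons; have [Pi|nPi] := boolP (P i).
  rewrite -IH -circle_meanD; last exact: bounded_measurable_sum.
    by apply: eq_Rintegral => x _; rewrite big_cons Pi.
  exact: hF.
by rewrite -IH; apply: eq_Rintegral => x _; rewrite big_cons (negbTE nPi).
Qed.

Lemma circle_mean_cst r : circle_mean (fun=> r) = r.
Proof.
rewrite /circle_mean Rintegral_cst// (_ : _ D = 1%E) ?mulr1//.
exact: circle_measure1.
Qed.

Lemma ler_circle_mean g h : bounded_measurable g -> bounded_measurable h ->
  (forall x, 0 <= x < 1 -> g x <= h x) -> circle_mean g <= circle_mean h.
Proof.
move=> bg bh gh; apply: le_Rintegral => //.
- exact: bounded_measurable_integrable.
- exact: bounded_measurable_integrable.
Qed.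

Lemma measure_circle_fin S : measurable S -> mu (S `&` D) \is a fin_num.
Proof.
move=> mS; rewrite ge0_fin_numE//.
apply: (@le_lt_trans _ _ (mu D)); last by rewrite circle_measure1 ltry.
by apply: le_measure; rewrite ?inE//; apply: measurableI.
Qed.

Lemma circle_mean_indic S : measurable S ->
  (circle_mean (\1_S))%:E = mu (S `&` D).
Proof.
by move=> mS; rewrite /circle_mean /Rintegral integral_indic// fineK// measure_circle_fin.
Qed.

Lemma circle_mean_indic_ge0 S : measurable S -> 0 <= circle_mean (\1_S).
Proof. by move=> mS; rewrite -lee_fin circle_mean_indic. Qed.

Lemma lipschitz_bounded_measurable g s M :
  (forall x y, `|g x - g y| <= s * `|x - y|) -> (forall x, `|g x| <= M) ->
  bounded_measurable g.
Proof.
move=> lip hM; split; last by exists M.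
apply: continuous_measurable_fun => x.
apply/cvgrPdist_le => /= e e0.
have s1 : 0 < `|s| + 1 by rewrite ltr_wpDl.
near=> y.
apply: (le_trans (lip _ _)).
apply: (@le_trans _ _ ((`|s| + 1) * (e / (`|s| + 1)))); last by rewrite mulrC divfK ?gt_eqF.
apply: (@le_trans _ _ ((`|s| + 1) * `|x - y|)).
  rewrite ler_wpM2r//; have := ler_norm s; lra.
rewrite ler_pM2l//; near: y.
by apply: cvgr_dist_le; rewrite ?divr_gt0.
Unshelve. all: by end_near. Qed.

Lemma circle_lipschitz_bounded_measurable phi s M : 0 <= s ->
  circle_lipschitz s phi -> (forall x, `|phi x| <= M) -> bounded_measurable phi.
Proof.
move=> s0 lip hM; apply: (@lipschitz_bounded_measurable _ s M) => // x y.
by rewrite (le_trans (lip x y))// ler_wpM2l// dist_int_le_abs.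
Qed.

Definition circle_arc x r : set R := [set y | dist_int (x + y) < r].

Lemma dist_int_le_half x : dist_int x <= 2^-1.
Proof.
have h1 := floor_le_tmp x; have := floorD1_gt x; rewrite rmorphD/= => h2.
have [h|h] := leP (x - (Num.floor x)%:~R) 2^-1.
  by rewrite (le_trans (dist_int_le_norm _ (Num.floor x)))// ger0_norm ?subr_ge0.
apply: (le_trans (dist_int_le_norm _ (Num.floor x + 1))).
by rewrite rmorphD/= ler_norml; lra.
Qed.

Lemma bounded_measurable_dist_int x : bounded_measurable (fun y => dist_int (x + y)).
Proof.
apply: (@circle_lipschitz_bounded_measurable _ 1 2^-1) => // [y z|y].
  rewrite mul1r ler_norml.
  have := dist_int_le_dist (x + y) (x + z); have := dist_int_le_dist (x + z) (x + y).
  rewrite (_ : x + z - (x + y) = - (y - z)); last by ring.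
  rewrite dist_intN (_ : x + y - (x + z) = y - z); last by ring.
  by move=> *; apply/andP; split; lra.
by rewrite ger0_norm ?dist_int_ge0// dist_int_le_half.
Qed.

Lemma measurable_dist_int_le x r : measurable [set y | dist_int (x + y) <= r].
Proof.
have [mg _] := bounded_measurable_dist_int x.
rewrite (_ : [set _ | _] = setT `&` (fun y => dist_int (x + y)) @^-1` `]-oo, r]).
  exact: mg.
by rewrite setTI; apply/seteqP; split => y /=; rewrite in_itv.
Qed.

Lemma measurable_circle_arc x r : measurable (circle_arc x r).
Proof.
have [mg _] := bounded_measurable_dist_int x.
rewrite (_ : circle_arc x r = setT `&` (fun y => dist_int (x + y)) @^-1` `]-oo, r[).
  exact: mg.
by rewrite setTI; apply/seteqP; split => y /=; rewrite in_itv.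
Qed.

Lemma circle_representative x : exists z, [/\ 0 <= z < 1 &
  forall y, dist_int (x + y) = dist_int (y - z)].
Proof.
exists (- x - (Num.floor (- x))%:~R); split.
  rewrite subr_ge0 floor_le_tmp/= ltrBlDr addrC.
  by have := floorD1_gt (- x); rewrite rmorphD.
move=> y; rewrite -(dist_intDz (x + y) (Num.floor (- x))).
by congr dist_int; ring.
Qed.

Lemma measure_dist_int_le x r : 0 <= r ->
  (mu ([set y | (dist_int (x + y) <= r)%R] `&` D) <= (6 * r)%:E)%E.
Proof.
move=> r0; have [r2|r2] := leP 2^-1 r.
  apply: (@le_trans _ _ (mu D)).
    by apply: le_measure; rewrite ?inE//; apply: measurableI => //; apply: measurable_dist_int_le.
  rewrite circle_measure1 lee_fin; lra.
(* With the centre [z] in the unit interval, only its translates by -1, 0 and 1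
   come close to the unit interval. *)
have [z [/andP[z0 z1] hz]] := circle_representative x.
pose I (k : R) : set R := `[z + k - r, z + k + r]%classic.
have mI k : mu (I k) = (2 * r)%:E.
  rewrite lebesgue_measure_itv/= lte_fin; case: ltP => h; last first.
    by congr (_%:E); lra.
  by rewrite -EFinB; congr (_%:E); ring.
have mmI k : measurable (I k) by exact: measurable_itv.
apply: (@le_trans _ _ (mu (I (-1) `|` I 0 `|` I 1))).
  apply: le_measure; rewrite ?inE//.
  - by apply: measurableI => //; apply: measurable_dist_int_le.
  - by apply: measurableU; [apply: measurableU; exact: mmI|exact: mmI].
  move=> y [/=]; rewrite hz in_itv/= => hy /andP[y0 y1].
  have [k hk] := dist_int_attained (y - z).
  move: hy; rewrite hk ler_norml => /andP[h1 h2].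
  have k1 : k%:~R < 2 :> R by lra.
  have k2 : - 2 < k%:~R :> R by lra.
  move: k1 k2; rewrite -[2 :> R]/(2%:~R) -rmorphN/= !ltr_int => k1 k2.
  have : k = -1 \/ k = 0 \/ k = 1 by lia.
  move=> [kE|[kE|kE]]; rewrite kE ?rmorphN/= in h1 h2.
  - by left; left; rewrite /I/= in_itv/=; apply/andP; split; lra.
  - by left; right; rewrite /I/= in_itv/=; apply/andP; split; lra.
  - by right; rewrite /I/= in_itv/=; apply/andP; split; lra.
apply: (@le_trans _ _ (mu (I (-1)%R) + mu (I 0%R) + mu (I 1%R))%E).
  apply: (le_trans (measureU2 _ _ _)); [by apply: measurableU; exact: mmI|exact: mmI|].
  by apply: leeD => //; apply: measureU2; exact: mmI.
by rewrite !mI -!EFinD lee_fin; lra.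
Qed.

Lemma circle_mean_arc_le x r : 0 <= r -> circle_mean (\1_(circle_arc x r)) <= 6 * r.
Proof.
move=> r0; rewrite -lee_fin circle_mean_indic; last exact: measurable_circle_arc.
apply: le_trans (measure_dist_int_le x r0); apply: le_measure; rewrite ?inE//.
- by apply: measurableI => //; exact: measurable_circle_arc.
- by apply: measurableI => //; exact: measurable_dist_int_le.
- by apply: setSI => y /ltW.
Qed.

(** One half of the arc, on the side of its centre that faces [1 / 2], lies in
    the unit interval; this avoids treating arcs that wrap around. *)
Lemma circle_mean_arc_ge x r : 0 <= r <= 2^-1 -> r <= circle_mean (\1_(circle_arc x r)).
Proof.
move=> /andP[r0 r2]; rewrite -lee_fin circle_mean_indic; last exact: measurable_circle_arc.
have [->|rn0] := eqVneq r 0; first by rewrite measure_ge0.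
have {r0 rn0} r0 : 0 < r by rewrite lt0r rn0.
have [z [/andP[z0 z1] hz]] := circle_representative x.
have mA : measurable (circle_arc x r `&` D) by apply: measurableI => //; exact: measurable_circle_arc.
have [z2|z2] := leP 2^-1 z.
  apply: (@le_trans _ _ (mu `]z - r, z]%classic)).
    rewrite lebesgue_measure_itv/= lte_fin ifT; last by lra.
    by rewrite -EFinB lee_fin; lra.
  apply: le_measure; rewrite ?inE// => y; rewrite /= in_itv/= => /andP[h1 h2].
  split; last by rewrite /= in_itv/=; apply/andP; split; lra.
  rewrite /circle_arc/= hz (le_lt_trans (dist_int_le_abs _))// ltr_norml.
  by apply/andP; split; lra.
apply: (@le_trans _ _ (mu `[z, z + r[%classic)).
  rewrite lebesgue_measure_itv/= lte_fin ifT; last by lra.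
  by rewrite -EFinB lee_fin; lra.
apply: le_measure; rewrite ?inE// => y; rewrite /= in_itv/= => /andP[h1 h2].
split; last by rewrite /= in_itv/=; apply/andP; split; lra.
rewrite /circle_arc/= hz (le_lt_trans (dist_int_le_abs _))// ltr_norml.
by apply/andP; split; lra.
Qed.

End CircleMeasure.

(** * Equidistribution along multiplicatively defined sets *)

Section Riemann.
Variable R : realType.
Implicit Types (x y z r s : R) (phi : R -> R).
Local Opaque dist_int.

Lemma division_points_shift s phi (q : nat) (k : int) x :
  circle_lipschitz s phi -> (0 < q)%N ->
  \sum_(j < q) phi (x + k%:~R / q%:R + j%:R / q%:R) =
  \sum_(j < q) phi (x + j%:R / q%:R).
Proof.
move=> lip; case: q => // q _.
pose S z := \sum_(j < q.+1) phi (z + j%:R / q.+1%:R).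
have q0 : q.+1%:R != 0 :> R by rewrite pnatr_eq0.
have S1 z : S (z + q.+1%:R^-1) = S z.
  rewrite /S big_ord_recr big_ord_recl/= mul0r addr0 addrC; congr (_ + _).
    rewrite (_ : z + _ + _ = z + 1%:~R) ?(circle_lipschitz_periodic _ _ lip)//.
    by rewrite -addrA; congr (_ + _); rewrite -natr1; field; rewrite natr1.
  apply: eq_bigr => j _; congr phi.
  by rewrite /bump/= add1n -[j.+1%:R]natr1 mulrDl mul1r; ring.
have Sn z (n : nat) : S (z + n%:R / q.+1%:R) = S z.
  elim: n => [|n IH]; first by rewrite mul0r addr0.
  by rewrite -[n.+1%:R]natr1 mulrDl mul1r addrA S1 IH.
change (S (x + k%:~R / q.+1%:R) = S x).
case: k => n; first exact: Sn.
rewrite NegzE -(Sn _ n.+1); congr S.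
by rewrite rmorphN/= mulNr subrK.
Qed.

(** The sum over [q]-division points is periodic in [x] of period [1 / q], so
    moving [x] to [0] costs at most [s]; comparing the sum at [0] with the
    integral, through a step function, costs another [s]. *)
Lemma riemann_sum_error phi s (q : nat) x : 0 <= s -> (0 < q)%N ->
  circle_lipschitz s phi -> (forall y, `|phi y| <= 1) ->
  `|\sum_(j < q) (phi (x + j%:R / q%:R) - circle_mean phi)| <= 2 * s.
Proof.
move=> s0 q0 lip phi1.
have qR : 0 < q%:R :> R by rewrite ltr0n.
pose S z := \sum_(j < q) phi (z + j%:R / q%:R).
have Sx : `|S x - S 0| <= s.
  set k := Num.floor (q%:R * x).
  have -> : S x = S (x - k%:~R / q%:R).
    rewrite /S -(division_points_shift k (x - k%:~R / q%:R) lip q0).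
    by apply: eq_bigr => j _; rewrite subrK.
  have h1 := floor_le_tmp (q%:R * x); have := floorD1_gt (q%:R * x).
  rewrite -/k in h1 *; rewrite rmorphD/= => h2.
  rewrite /S -sumrB (le_trans (ler_norm_sum _ _ _))//.
  apply: (@le_trans _ _ (\sum_(j < q) s / q%:R)); last first.
    by rewrite sumr_const card_ord -[_ *+ q]mulr_natr divfK// gt_eqF.
  apply: ler_sum => j _; apply: (le_trans (lip _ _)); rewrite ler_wpM2l//.
  apply: (le_trans (dist_int_le_abs _)).
  rewrite (_ : _ - _ = (q%:R * x - k%:~R) / q%:R); last by field; rewrite gt_eqF.
  rewrite normrM ger0_norm ?subr_ge0// gtr0_norm ?invr_gt0//.
  by rewrite ler_pdivrMr// mulVf ?gt_eqF//; lra.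
have bphi : bounded_measurable phi.
  exact: (circle_lipschitz_bounded_measurable s0 lip phi1).
pose I (j : 'I_q) : set R := `[j%:R / q%:R, j.+1%:R / q%:R[%classic.
have mI j : measurable (I j) by exact: measurable_itv.
have meanI j : circle_mean (\1_(I j)) = q%:R^-1.
  apply/EFin_inj; rewrite circle_mean_indic// setIidl.
    rewrite lebesgue_measure_itv/= lte_fin ltr_pM2r ?invr_gt0// ltr_nat ltnSn.
    by rewrite -EFinB -mulrBl -natr1 addrC addKr mul1r.
  move=> y; rewrite /I/= !in_itv/= => /andP[h1 h2]; apply/andP; split.
    by apply: le_trans h1; rewrite divr_ge0.
  by apply: (lt_le_trans h2); rewrite ler_pdivrMr// mul1r ler_nat.
pose step y : R := \sum_(j < q) phi (j%:R / q%:R) * \1_(I j) y.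
have bstep : bounded_measurable step.
  apply: bounded_measurable_sum => j _; apply: bounded_measurableZ.
  exact: bounded_measurable_indic.
have mean_step : circle_mean step = S 0 / q%:R.
  rewrite /step circle_mean_sum; last first.
    by move=> j _; apply/bounded_measurableZ/bounded_measurable_indic.
  rewrite /S mulr_suml; apply: eq_bigr => j _.
  by rewrite circle_meanZ ?meanI ?add0r//; apply: bounded_measurable_indic.
have near y : 0 <= y < 1 -> `|phi y - step y| <= s / q%:R.
  move=> /andP[y0 y1].
  have qy0 : 0 <= q%:R * y by rewrite mulr_ge0.
  have /andP[t1 t2] := truncn_itv qy0.
  have tq : (Num.trunc (q%:R * y) < q)%N.
    by rewrite -(ltr_nat R) (le_lt_trans t1)// gtr_pMr.
  pose j := Ordinal tq.
  have -> : step y = phi (j%:R / q%:R).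
    rewrite /step (bigD1 j)//= indicE mem_set ?mulr1; last first.
      by rewrite /I/= in_itv/= ler_pdivrMr// ltr_pdivlMr// ![y * _]mulrC t1 t2.
    rewrite big1 ?addr0// => i ij; rewrite indicE memNset ?mulr0//.
    rewrite /I/= in_itv/= ler_pdivrMr// ltr_pdivlMr// ![y * _]mulrC => /andP[i1 i2].
    move/eqP: ij; apply; apply/val_inj; rewrite /=.
    by rewrite (@truncn_def _ _ i)// i1.
  apply: (le_trans (lip _ _)); rewrite ler_wpM2l//.
  apply: (le_trans (dist_int_le_abs _)).
  rewrite (_ : _ - _ = (q%:R * y - j%:R) / q%:R); last by field; rewrite gt_eqF.
  rewrite normrM ger0_norm ?subr_ge0// gtr0_norm ?invr_gt0//.
  rewrite ler_pdivrMr// mulVf ?gt_eqF//.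
  by rewrite -natr1 in t2; rewrite /=; lra.
have hmean : `|S 0 - q%:R * circle_mean phi| <= s.
  have hs : bounded_measurable (fun=> s / q%:R) by exact: bounded_measurable_cst.
  have h1 : circle_mean phi <= circle_mean step + s / q%:R.
    rewrite -[X in _ <= _ + X]circle_mean_cst -circle_meanD//.
    apply: ler_circle_mean => //; first exact: bounded_measurableD.
    by move=> y /near; rewrite ler_norml => /andP[] *; lra.
  have h2 : circle_mean step <= circle_mean phi + s / q%:R.
    rewrite -[X in _ <= _ + X]circle_mean_cst -circle_meanD//.
    apply: ler_circle_mean => //; first exact: bounded_measurableD.
    by move=> y /near; rewrite ler_norml => /andP[] *; lra.
  rewrite mean_step in h1 h2.
  rewrite -mulrDl ler_pdivlMr// in h1; rewrite ler_pdivrMr// mulrDl divfK ?gt_eqF// in h2.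
  by rewrite ler_norml; apply/andP; split; lra.
rewrite sumrB sumr_const card_ord -[X in _ - X]mulr_natl -/(S x).
by move: Sx hmean; rewrite !ler_norml => /andP[? ?] /andP[? ?]; apply/andP; split; lra.
Qed.

(** Kátai's criterion applied to [phi] minus its mean, a function whose
    correlations decay by [correlation_bound] and [riemann_sum_error]. *)
Lemma equidistribution_along (V : finType) (f : nat -> V) (A : pred nat)
  (G : V -> V -> bool) (alpha s eps : R) (phi : R -> R) :
  (forall p m, prime p -> (0 < m)%N -> ~~ (p %| m)%N ->
    A (p * m)%N = G (f p) (f m)) ->
  badly_approximable alpha -> 0 < s -> circle_lipschitz s phi ->
  (forall y, 0 <= phi y <= 1) -> 0 < eps ->
  exists2 K, 0 <= K & forall N,
    `|\sum_(1 <= n < N.+1) (A n)%:R * (phi (n%:R * alpha) - circle_mean phi)|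
    <= eps * N%:R + K.
Proof.
move=> hA bad s0 lip phi01 eps0.
have phi1 y : `|phi y| <= 1.
  by rewrite ler_norml; have /andP[? ?] := phi01 y; apply/andP; split; lra.
have bphi : bounded_measurable phi.
  exact: (circle_lipschitz_bounded_measurable (ltW s0) lip phi1).
have mean01 : 0 <= circle_mean phi <= 1.
  apply/andP; split.
    rewrite -[X in X <= _]circle_mean_cst; apply: ler_circle_mean => //.
      exact: bounded_measurable_cst.
    by move=> y _; have /andP[] := phi01 y.
  rewrite -[X in _ <= X]circle_mean_cst; apply: ler_circle_mean => //.
    exact: bounded_measurable_cst.
  by move=> y _; have /andP[] := phi01 y.
pose phi0 y := phi y - circle_mean phi.
have phi01' y : `|phi0 y| <= 1.
  have /andP[? ?] := phi01 y; case/andP: mean01 => ? ?.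
  by rewrite /phi0 ler_norml; apply/andP; split; lra.
have lip0 : circle_lipschitz s phi0.
  by move=> x y; rewrite /phi0 opprB addrA subrK.
have hC (pq : nat * nat) : exists C : R, 0 <= C /\
  (prime pq.1 -> prime pq.2 -> (pq.1 < pq.2)%N -> forall M,
  `|\sum_(1 <= m < M.+1) phi0 ((pq.1 * m)%:R * alpha) * phi0 ((pq.2 * m)%:R * alpha)|
   <= 3 * s / pq.2%:R * M%:R + C).
  case: pq => p q /=.
  have [/and3P[pp pq lt]|h] := boolP [&& prime p, prime q & (p < q)%N]; last first.
    by exists 0; split => // pp pq lt; rewrite pp pq lt in h.
  have [C C0 hC] := @correlation_bound R phi0 s alpha p q bad s0
    (introT andP (conj (prime_gt0 pp) lt)) (ltac:(by rewrite prime_coprime// dvdn_prime2// ltn_eqF))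
    phi01' lip0 (fun x => riemann_sum_error x (ltW s0) (prime_gt0 pq) lip phi1).
  by exists C.
have [C HC] := choice hC.
have s3 : 0 <= 3 * s by rewrite mulr_ge0// ltW.
exact: (@katai_criterion R V f A G hA (fun n => phi0 (n%:R * alpha)) (3 * s)
  (fun n => phi01' _) s3 (fun p q => C (p, q)) (fun p q => (HC (p, q)).1)
  (fun p q => (HC (p, q)).2) eps eps0).
Qed.

End Riemann.

(** * Second moment of the number of arcs through a point *)

Section SecondMoment.
Variable R : realType.
Implicit Types (x y z r s : R).
Local Opaque dist_int.

(** Each point of [Z] can be charged to the [dd] indices that end at it; these
    runs of indices are disjoint, and the weight only decreases along them. *)
Lemma sparse_sum (psi : nat -> R) (Z : pred nat) (n dd N : nat) :
  (forall i, (n < i)%N -> 0 <= psi i) ->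
  (forall i j, (n < i)%N -> (i <= j)%N -> psi j <= psi i) ->
  (forall i, (n < i)%N -> Z i -> (n + dd <= i)%N) ->
  (forall i j, (n < i)%N -> (i < j)%N -> Z i -> Z j -> (i + dd <= j)%N) ->
  (0 < dd)%N ->
  dd%:R * \sum_(n.+1 <= i < N.+1 | Z i) psi i <= \sum_(n.+1 <= i < N.+1) psi i.
Proof.
move=> psi0 psi_decr Zn ZZ d0.
elim/ltn_ind: N => N IH.
have [Nn|nN] := leqP N n; first by rewrite !big_geq// mulr0.
have [ZN|ZN] := boolP (Z N); last first.
  case: N nN ZN IH => // N; rewrite ltnS => nN ZN IH.
  rewrite big_mkcond !(@big_nat_recr _ _ _ N.+1 n.+1)//= -big_mkcond (negbTE ZN) addr0.
  rewrite (le_trans (IH N _))// lerDl psi0//.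
have dN := Zn _ nN ZN.
have dN' : (n.+1 <= (N - dd).+1)%N by lia.
have dN'' : ((N - dd).+1 <= N.+1)%N by lia.
rewrite !(@big_cat_nat _ _ _ (N - dd).+1 n.+1 N.+1)//= mulrDr lerD//.
  by apply: IH; lia.
have -> : \sum_((N - dd).+1 <= i < N.+1 | Z i) psi i = psi N.
  rewrite big_mkcond big_nat_recr/=; last by lia.
  rewrite ZN big_nat_cond big1 ?add0r// => i; rewrite andbT => /andP[i1 i2].
  case: ifP => // Zi.
  have /(_ _ _) := ZZ i N; lia.
have -> : dd%:R * psi N = \sum_((N - dd).+1 <= i < N.+1) psi N.
  by rewrite sumr_const_nat mulr_natl; congr (_ *+ _); lia.
by apply: ler_sum_nat => i /andP[i1 i2]; apply: psi_decr; lia.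
Qed.

Variables (alpha c : R) (psi : nat -> R) (N : nat).
Hypothesis c0 : 0 < c.
Hypothesis bad : forall n, (0 < n)%N -> c <= n%:R * dist_int (n%:R * alpha).
Hypothesis psi0 : forall n, (0 < n)%N -> 0 <= psi n.
Hypothesis psi_decr : forall n m, (0 < n)%N -> (n <= m)%N -> psi m <= psi n.

Let S := \sum_(1 <= n < N.+1) psi n.
Let b n : R -> R := \1_(circle_arc (n%:R * alpha) (psi n)).
Let close n m : bool := dist_int ((m - n)%:R * alpha) < 2 * psi n.

(** For [m] close to [n], the number [m - n] times [alpha] is within [2 psi n] of
    an integer, hence two such [m] differ by a number whose multiple of [alpha]
    is within [4 psi n] of an integer. As [alpha] is badly approximable, the gaps
    are at least [c / (4 psi n)]. *)
Lemma sum_close_ler n : (0 < n)%N ->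
  \sum_(1 <= m < N.+1) ((n < m)%N && close n m)%:R * psi m <=
  4 * psi n / c * S.
Proof.
move=> n0.
have S0 : 0 <= S.
  by rewrite /S big_nat_cond sumr_ge0// => i /andP[/andP[? _] _]; exact: psi0.
have [psin|psin] := leP (psi n) 0.
  rewrite big1 => [|m _].
    by rewrite mulr_ge0// divr_ge0 ?mulr_ge0 ?psi0// ltW.
  rewrite /close ltNge (_ : _ <= _)%R ?andbF ?mul0r//.
  by apply: le_trans (dist_int_ge0 _); lra.
set dd := (Num.trunc (c / (4 * psi n))).+1.
have p4 : 0 < 4 * psi n by lra.
have cp0 : 0 <= c / (4 * psi n) by rewrite divr_ge0// ltW.
have ddP k : (0 < k)%N -> dist_int (k%:R * alpha) < 4 * psi n -> (dd <= k)%N.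
  move=> k0 hk; rewrite /dd -(ltr_nat R).
  rewrite (@le_lt_trans _ _ (c / (4 * psi n))) ?truncn_le//.
  rewrite ltr_pdivrMr// (le_lt_trans (bad k0))// ltr_pM2l// ltr0n//.
have [Nn|nN] := leqP N n.
  rewrite big_nat_cond big1 => [|m /andP[/andP[_ mN] _]].
    by rewrite mulr_ge0// divr_ge0 ?ltW.
  by rewrite (_ : (n < m)%N = false) ?mul0r//; lia.
have key : dd%:R * \sum_(n.+1 <= m < N.+1 | close n m) psi m <=
    \sum_(n.+1 <= m < N.+1) psi m.
  apply: sparse_sum => //.
  - by move=> i ni; apply: psi0; lia.
  - by move=> i j ni; apply: psi_decr; lia.
  - move=> i ni; rewrite /close => ci.
    suff : (dd <= i - n)%N by lia.
    by apply: ddP; [lia|lra].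
  - move=> i j ni ij; rewrite /close => ci cj.
    suff : (dd <= j - i)%N by lia.
    apply: ddP; first lia.
    have -> : (j - i)%:R * alpha = (j - n)%:R * alpha - (i - n)%:R * alpha.
      by rewrite -mulrBl -natrB; [congr (_%:R * _); lia|lia].
    by apply: (le_lt_trans (dist_intB _ _)); lra.
have -> : \sum_(1 <= m < N.+1) ((n < m)%N && close n m)%:R * psi m =
    \sum_(n.+1 <= m < N.+1 | close n m) psi m.
  rewrite (@big_cat_nat _ _ _ n.+1 1 N.+1)//=; last by lia.
  rewrite big_nat_cond big1 ?add0r; last first.
    move=> m /andP[/andP[_ mn] _].
    by rewrite (_ : (n < m)%N = false) ?mul0r//; lia.
  rewrite [RHS]big_mkcond; apply: eq_big_nat => m /andP[nm _].
  by rewrite nm/=; case: close; rewrite ?mul1r ?mul0r.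
set X := \sum_(_ <= _ < _ | _) _ in key *.
have X0 : 0 <= X.
  rewrite /X big_nat_cond sumr_ge0// => i /andP[/andP[? _] _]; apply: psi0; lia.
have key2 : dd%:R * X <= S.
  apply: (le_trans key); rewrite /S (@big_cat_nat _ _ _ n.+1 1 N.+1)//=; last by lia.
  rewrite lerDr big_nat_cond sumr_ge0// => i /andP[/andP[? _] _]; exact: psi0.
have hd : c / (4 * psi n) <= dd%:R by rewrite ltW// truncnS_gt.
have : c / (4 * psi n) * X <= S.
  by apply: le_trans key2; rewrite ler_wpM2r.
rewrite -ler_pdivlMl ?divr_gt0// invf_div => /le_trans; apply.
by [].
Qed.

(** Two arcs with indices [n < m] meet only if [m] is close to [n], and by
    [sum_close_ler] this is as rare as if the arcs were independent. *)
Lemma second_moment (A : pred nat) :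
  circle_mean (fun y => (\sum_(1 <= n < N.+1) (A n)%:R * b n y) ^+ 2) <=
  6 * S + 48 / c * S ^+ 2.
Proof.
pose near n m : R := ((n < m)%N && close n m)%:R.
pose B n m y : R := (n == m)%:R * b n y + (near n m * b m y + near m n * b n y).
have b01 n y : 0 <= b n y <= 1 by rewrite /b indicE; case: (_ \in _); rewrite /= ?lexx ?ler01.
have bmb n : bounded_measurable (b n).
  by apply: bounded_measurable_indic; exact: measurable_circle_arc.
have bmB n m : bounded_measurable (B n m).
  apply: bounded_measurableD; first exact: bounded_measurableZ.
  by apply: bounded_measurableD; exact: bounded_measurableZ.
have bb n m y : (0 < n)%N -> (0 < m)%N -> b n y * b m y <= B n m y.
  move=> n0 m0.
  have near0 i j : 0 <= near i j * b j y.
    by rewrite mulr_ge0//; case/andP: (b01 j y).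
  have lt_case i j : (0 < i)%N -> (i < j)%N -> b i y * b j y <= near i j * b j y.
    move=> i0 ij; rewrite /near ij/=.
    have [/set_mem hi|/negP hi] := boolP (y \in circle_arc (i%:R * alpha) (psi i)); last first.
      by rewrite {1}/b indicE (negbTE (introN idP hi)) mul0r mulr_ge0//; case/andP: (b01 j y).
    have [/set_mem hj|/negP hj] := boolP (y \in circle_arc (j%:R * alpha) (psi j)); last first.
      by rewrite /b [\1_(circle_arc (j%:R * _) _) y]indicE (negbTE (introN idP hj)) !mulr0.
    have cl : close i j.
      rewrite /close natrB ?(ltnW ij)// mulrBl.
      rewrite (_ : _ - _ = (j%:R * alpha + y) - (i%:R * alpha + y)); last by ring.
      apply: (le_lt_trans (dist_intB _ _)).
      rewrite /circle_arc/= in hi hj.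
      by have := psi_decr i0 (ltnW ij); lra.
    have /andP[_ hi1] := b01 i y; have /andP[hj0 _] := b01 j y.
    by rewrite cl ler_wpM2r.
  rewrite /B; have [lt|lt|<-] := ltngtP n m.
  - rewrite mul0r add0r (le_trans (lt_case _ _ n0 lt))// lerDl.
    by rewrite /near ltnNge ltnW// mul0r.
  - rewrite mul0r add0r mulrC (le_trans (lt_case _ _ m0 lt))// lerDr.
    by rewrite /near ltnNge ltnW// mul0r.
  - rewrite mul1r /near ltnn/= !mul0r !addr0.
    by have /andP[h0 h1] := b01 n y; rewrite ler_piMl.
apply: (@le_trans _ _ (circle_mean (fun y =>
    \sum_(1 <= n < N.+1) \sum_(1 <= m < N.+1) B n m y))).
  apply: ler_circle_mean.
  - under eq_fun do rewrite expr2.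
    by apply: bounded_measurableM; apply: bounded_measurable_sum => n _;
      exact: bounded_measurableZ.
  - by apply: bounded_measurable_sum => n _; apply: bounded_measurable_sum.
  - move=> y _; rewrite expr2 mulr_suml.
    apply: ler_sum_nat => n /andP[n0 _].
    rewrite mulr_sumr.
    apply: ler_sum_nat => m /andP[m0 _].
    apply: le_trans (bb n m y n0 m0).
    have /andP[h0 h1] := b01 n y; have /andP[k0 k1] := b01 m y.
    by case: (A n); case: (A m); rewrite ?mul1r ?mul0r ?mulr0 ?mulr_ge0.
rewrite circle_mean_sum; last by move=> n _; apply: bounded_measurable_sum.
have mb n : (0 < n)%N -> circle_mean (b n) <= 6 * psi n.
  by move=> n0; apply: circle_mean_arc_le; exact: psi0.
have near0 n m : 0 <= near n m by [].
have mB n m : (0 < n)%N -> (0 < m)%N -> circle_mean (B n m) <=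
    (n == m)%:R * (6 * psi n) + (near n m * (6 * psi m) + near m n * (6 * psi n)).
  move=> n0 m0; rewrite circle_meanD; [|exact: bounded_measurableZ|
    by apply: bounded_measurableD; exact: bounded_measurableZ].
  rewrite circle_meanD; try exact: bounded_measurableZ.
  by rewrite !circle_meanZ// !lerD// ler_wpM2l// mb.
have step1 : \sum_(1 <= n < N.+1) circle_mean (fun y => \sum_(1 <= m < N.+1) B n m y)
  <= \sum_(1 <= n < N.+1) \sum_(1 <= m < N.+1)
    ((n == m)%:R * (6 * psi n) + (near n m * (6 * psi m) + near m n * (6 * psi n))).
  apply: ler_sum_nat => n /andP[n0 _].
  rewrite circle_mean_sum//.
  by apply: ler_sum_nat => m /andP[m0 _]; exact: mB.
apply: (le_trans step1).
have diag : \sum_(1 <= n < N.+1) \sum_(1 <= m < N.+1) (n == m)%:R * (6 * psi n) <= 6 * S.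
  rewrite /S mulr_sumr.
    apply: ler_sum_nat => n /andP[n0 nN].
  rewrite -mulr_suml ler_piMl//; first by rewrite mulr_ge0// psi0.
  rewrite (@le_trans _ _ (\sum_(1 <= m < N.+1 | m == n) 1))//.
    rewrite [leRHS]big_mkcond ler_sum// => m _; rewrite eq_sym.
    by case: eqP.
  by rewrite big_nat1_eq; case: ifP.
have off : \sum_(1 <= n < N.+1) \sum_(1 <= m < N.+1) near n m * (6 * psi m) <=
    24 / c * S ^+ 2.
  have -> : 24 / c * S ^+ 2 = \sum_(1 <= n < N.+1) 6 * (4 * psi n / c * S).
    rewrite -mulr_sumr -mulr_suml -[in RHS]mulr_suml -mulr_sumr -/S.
    by field; rewrite gt_eqF.
  apply: ler_sum_nat => n /andP[n0 nN].
  under eq_bigr do rewrite mulrCA.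
  by rewrite -mulr_sumr ler_wpM2l// sum_close_ler.
have off' : \sum_(1 <= n < N.+1) \sum_(1 <= m < N.+1) near m n * (6 * psi n) <=
    24 / c * S ^+ 2 by rewrite exchange_big.
have -> : \sum_(1 <= n < N.+1) \sum_(1 <= m < N.+1)
    ((n == m)%:R * (6 * psi n) + (near n m * (6 * psi m) + near m n * (6 * psi n))) =
  \sum_(1 <= n < N.+1) \sum_(1 <= m < N.+1) (n == m)%:R * (6 * psi n) +
  (\sum_(1 <= n < N.+1) \sum_(1 <= m < N.+1) near n m * (6 * psi m) +
   \sum_(1 <= n < N.+1) \sum_(1 <= m < N.+1) near m n * (6 * psi n)).
  by rewrite -!big_split/=; apply: eq_bigr => n _; rewrite -!big_split.
have -> : 48 / c * S ^+ 2 = 24 / c * S ^+ 2 + 24 / c * S ^+ 2 by field; rewrite gt_eqF.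
by rewrite !lerD.
Qed.

End SecondMoment.

(** * Bumps around closed sets and Abel summation *)

Section FullMeasure.
Variable R : realType.
Implicit Types (x y z r s : R) (F : set R).
Local Opaque dist_int.
Notation mu := (@lebesgue_measure R).
Notation D := (`[0%R, 1%R[%classic : set R).

Definition circle_dist F x : R := inf [set dist_int (x - y) | y in F].

Lemma circle_dist_le F x y : F y -> circle_dist F x <= dist_int (x - y).
Proof.
move=> Fy; apply: inf_lbound; last by exists y.
by exists 0 => _ [z _ <-]; exact: dist_int_ge0.
Qed.

Lemma circle_dist_approx F x r : F !=set0 -> circle_dist F x < r ->
  exists2 y, F y & dist_int (x - y) < r.
Proof.
move=> [y0 Fy0] hr.
have hi : has_inf [set dist_int (x - y) | y in F].
  split; first by exists (dist_int (x - y0)); exists y0.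
  by exists 0 => _ [z _ <-]; exact: dist_int_ge0.
have e0 : 0 < r - circle_dist F x by rewrite subr_gt0.
have [_ [y Fy <-] hy] := inf_adherent e0 hi.
by exists y => //; rewrite (lt_le_trans hy)// /circle_dist [leLHS]addrC subrK.
Qed.

Lemma circle_dist_ge0 F x : F !=set0 -> 0 <= circle_dist F x.
Proof.
move=> F0; rewrite leNgt; apply/negP => /(circle_dist_approx F0)[y _].
by rewrite ltNge dist_int_ge0.
Qed.

Lemma circle_dist_lip F x y : F !=set0 ->
  circle_dist F x <= circle_dist F y + dist_int (x - y).
Proof.
move=> F0; apply/ler_addgt0Pr => e e0.
have : circle_dist F y < circle_dist F y + e by rewrite ltrDl.
move=> /(circle_dist_approx F0)[z Fz hz].
apply: (le_trans (circle_dist_le x Fz)).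
rewrite (_ : x - z = (x - y) + (y - z)); last by ring.
by apply: (le_trans (dist_intD _ _)); lra.
Qed.

(** A bump around [F]: it equals [1] on [F], vanishes at distance [1 / s] from
    [F] and is Lipschitz with constant [s]. *)
Definition tent F s x : R := Num.max 0 (1 - s * circle_dist F x).

Lemma tent_lipschitz F s : F !=set0 -> 0 <= s -> circle_lipschitz s (tent F s).
Proof.
move=> F0 s0 x y.
have h u v : tent F s u <= tent F s v + s * dist_int (u - v).
  have hd : 0 <= s * dist_int (u - v) by rewrite mulr_ge0// dist_int_ge0.
  have hv : 0 <= tent F s v by rewrite le_max lexx.
  have hv' : 1 - s * circle_dist F v <= tent F s v by rewrite le_max lexx orbT.
  have := ler_wpM2l s0 (circle_dist_lip v u F0).
  rewrite -[dist_int (v - u)]dist_intN opprB mulrDr => hc.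
  by rewrite {1}/tent ge_max; apply/andP; split; lra.
have h1 := h x y; have := h y x; rewrite -[dist_int (y - x)]dist_intN opprB => h2.
by rewrite ler_norml; apply/andP; split; lra.
Qed.

Lemma tent01 F s x : F !=set0 -> 0 <= s -> 0 <= tent F s x <= 1.
Proof.
move=> F0 s0; rewrite le_max lexx/= ge_max ler01/=.
by rewrite gerBl mulr_ge0// circle_dist_ge0.
Qed.

Lemma tent_eq1 F s x : F !=set0 -> F x -> tent F s x = 1.
Proof.
move=> F0 Fx; have -> : tent F s x = Num.max 0 (1 - s * 0).
  congr (Num.max 0 (1 - s * _)); apply/le_anti; rewrite circle_dist_ge0// andbT.
  by have := circle_dist_le x Fx; rewrite subrr (dist_int_intr _ 0).
by rewrite mulr0 subr0; apply: max_r.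
Qed.

Lemma measurable_circle_dist F : F !=set0 -> measurable_fun setT (circle_dist F).
Proof.
move=> F0; apply: continuous_measurable_fun.
move=> x; apply/cvgrPdist_le => /= e e0; near=> y.
have : `|x - y| <= e by near: y; apply: cvgr_dist_le.
apply: le_trans; apply: (@le_trans _ _ (dist_int (x - y))); last exact: dist_int_le_abs.
have := circle_dist_lip x y F0; have := circle_dist_lip y x F0.
by rewrite -[dist_int (y - x)]dist_intN opprB ler_norml => *; apply/andP; split; lra.
Unshelve. all: by end_near. Qed.

(** The rims shrink to the empty set as [s] grows, because [F] is closed, so
    their measures tend to [0]. *)
Lemma tent_support_small F r : F !=set0 -> measurable F ->
  (forall x, circle_dist F x = 0 -> F x) -> 0 < r ->
  exists2 s, 0 < s &
    measurable ([set x | 0 < tent F s x] `\` F) /\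
    circle_mean (\1_([set x | 0 < tent F s x] `\` F)) <= r.
Proof.
move=> F0 mF clF r0.
pose U (n : nat) : set R := [set x | 0 < tent F n.+1%:R x] `\` F.
have UE n : U n = [set x | circle_dist F x < n.+1%:R^-1] `\` F.
  congr (_ `\` _); apply/seteqP; split=> x /=; rewrite /tent lt_max ltxx/= subr_gt0.
    by rewrite -ltr_pdivlMl// mulr1.
  by move=> h; rewrite -ltr_pdivlMl// mulr1.
have mU n : measurable (U n).
  rewrite UE; apply: measurableD => //.
  rewrite (_ : [set _ | _] = setT `&` circle_dist F @^-1` `]-oo, n.+1%:R^-1[).
    exact: (measurable_circle_dist F0).
  by rewrite setTI; apply/seteqP; split => y /=; rewrite in_itv.
have capU : \bigcap_n (U n `&` D) = set0.
  rewrite -subset0 => x Ux.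
  have [[_ nF] _] := Ux 0%N I; apply: nF; apply: clF.
  apply/le_anti; rewrite circle_dist_ge0// andbT.
  apply/ler_addgt0Pr => e e0; rewrite add0r.
  pose n := Num.trunc e^-1.
  have := (Ux n I).1; rewrite UE => -[/= h _]; rewrite (le_trans (ltW h))//.
  by rewrite invf_ple ?posrE// ltW// truncnS_gt.
have cv : mu \o (fun n => U n `&` D) @ \oo --> mu (\bigcap_n (U n `&` D)).
  apply: nonincreasing_cvg_mu.
  - by rewrite -ge0_fin_numE// measure_circle_fin.
  - by move=> n; apply: measurableI; [exact: mU|exact: measurable_itv].
  - by rewrite capU.
  - move=> n m nm; apply/subsetPset; apply: setSI; rewrite !UE.
    move=> x [/= h nF]; split => //=; apply: (lt_le_trans h).
    by rewrite lef_pV2 ?posrE// ler_nat.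
rewrite capU measure0 in cv.
have : \forall n \near \oo, ((mu \o (fun n => U n `&` D)) n < r%:E)%E.
  apply: (cv [set e | (e < r%:E)%E]); apply: open_nbhs_nbhs; split.
    exact: open_ereal_lt_ereal.
  by rewrite /= lte_fin.
move=> [n _ /(_ n (leqnn n))/= hn].
exists n.+1%:R => //; split; first exact: mU.
by rewrite -lee_fin (circle_mean_indic (mU n)); apply: ltW.
Qed.

(** Abel summation: a nonincreasing weight is a nonnegative combination of the
    indicators of initial segments. *)
Lemma abel_lower_bound (w psi : nat -> R) (k K : R) (N : nat) :
  (forall n, (0 < n)%N -> 0 <= psi n) ->
  (forall n m, (0 < n)%N -> (n <= m)%N -> psi m <= psi n) ->
  0 <= K ->
  (forall M, k * M%:R - K <= \sum_(1 <= n < M.+1) w n) ->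
  k * \sum_(1 <= n < N.+1) psi n - K * psi 1%N <=
  \sum_(1 <= n < N.+1) w n * psi n.
Proof.
move=> psi0 psi_decr K0 hw.
have hw' M : 0 <= \sum_(1 <= n < M.+1) (w n - k) + K.
  rewrite sumrB sumr_const_nat subn1/= -[k *+ M]mulr_natr; have := hw M; lra.
(* Keeping the last partial sum on the left makes the claim inductive. *)
suff : psi N.+1 * (\sum_(1 <= n < N.+1) (w n - k) + K) - K * psi 1%N <=
    \sum_(1 <= n < N.+1) (w n - k) * psi n.
  have := mulr_ge0 (psi0 N.+1 isT) (hw' N).
  rewrite mulr_sumr => h0 /(le_trans (lerD h0 (lexx _))).
  under [X in _ <= X -> _]eq_bigr do rewrite mulrBl.
  by rewrite sumrB; lra.
elim: N => [|N IH].
  by rewrite !big_geq// add0r mulrC subrr.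
rewrite big_nat_recr//= [leRHS]big_nat_recr//=.
apply: (@le_trans _ _ (psi N.+1 * (\sum_(1 <= n < N.+1) (w n - k) + K) - K * psi 1%N +
    (w N.+1 - k) * psi N.+1)); last by rewrite lerD2r.
have := ler_wpM2r (hw' N.+1) (psi_decr N.+1 N.+2 isT (leqnSn _)).
by rewrite big_nat_recr//=; lra.
Qed.

(** Either [psi] never falls below [eta], and the truncated terms are constant,
    or it does so once and for all, and only finitely many terms change. *)
Lemma truncated_divergence (psi : nat -> R) (eta : R) : 0 < eta ->
  (forall n, (0 < n)%N -> 0 <= psi n) ->
  (forall n m, (0 < n)%N -> (n <= m)%N -> psi m <= psi n) ->
  (forall B, exists N, B <= \sum_(1 <= n < N.+1) psi n) ->
  forall B, exists N, B <= \sum_(1 <= n < N.+1) Num.min (psi n) eta.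
Proof.
move=> eta0 psi0 psi_decr div B.
have [h|] := pselect (forall n, (0 < n)%N -> eta <= psi n).
  exists (Num.trunc (B / eta)).+1.
  apply: (@le_trans _ _ (\sum_(1 <= n < (Num.trunc (B / eta)).+2) eta)).
    rewrite sumr_const_nat subn1/= -[_ *+ _]mulr_natl -ler_pdivrMr//.
    by rewrite ltW// truncnS_gt.
  by apply: ler_sum_nat => n /andP[n0 _]; rewrite le_min lexx h.
move=> /existsNP[n0 /not_implyP[n01 /negP]]; rewrite -ltNge => hn0.
have [N hN] := div (B + n0%:R * psi 1%N).
exists N; rewrite -(lerD2r (n0%:R * psi 1%N)) (le_trans hN)//.
apply: (@le_trans _ _ (\sum_(1 <= n < N.+1) (Num.min (psi n) eta + (n < n0)%N%:R * psi 1%N))).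
  apply: ler_sum_nat => n /andP[n1 _].
  have [nn|nn] := ltnP n n0.
    have := psi_decr 1%N n isT n1; have : 0 <= Num.min (psi n) eta.
      by rewrite le_min psi0// ltW.
    by rewrite mul1r; lra.
  rewrite mul0r addr0 le_min lexx/= (le_trans _ (ltW hn0))//.
  exact: psi_decr.
by rewrite big_split/= lerD2l -mulr_suml ler_wpM2r ?psi0// sum_ltn_ler.
Qed.

End FullMeasure.

(** * Points avoiding all arcs are negligible *)

Section Avoiding.
Variable R : realType.
Implicit Types (x y z r s : R) (psi : nat -> R) (A : pred nat).
Local Opaque dist_int.
Notation mu := (@lebesgue_measure R).
Notation D := (`[0%R, 1%R[%classic : set R).

(** The inequality on [psi] is not strict, so that the set is closed and a bump
    can shrink to it. *)
Definition avoiding_set A alpha psi (J : nat) : set R :=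
  [set y | forall n, (0 < n)%N -> (J <= n)%N -> A n ->
             psi n <= dist_int (n%:R * alpha + y)].

Lemma measurable_avoiding_set A alpha psi J :
  measurable (avoiding_set A alpha psi J).
Proof.
have -> : avoiding_set A alpha psi J =
    \bigcap_(n in [set n | [/\ (0 < n)%N, (J <= n)%N & A n]])
      ~` circle_arc (n%:R * alpha) (psi n).
  apply/seteqP; split=> y h n.
    by move=> [n0 Jn An] /=; rewrite /circle_arc/= ltNge h.
  move=> n0 Jn An; have := h n (And3 n0 Jn An).
  by rewrite /circle_arc/= => /negP; rewrite -leNgt.
apply: bigcap_measurableType => n _; apply: measurableC; exact: measurable_circle_arc.
Qed.

Lemma avoiding_set_closed A alpha psi J x : avoiding_set A alpha psi J !=set0 ->
  circle_dist (avoiding_set A alpha psi J) x = 0 -> avoiding_set A alpha psi J x.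
Proof.
move=> F0 dx n n0 Jn An; apply/ler_addgt0Pr => e e0.
have := e0; rewrite -{1}dx => /(circle_dist_approx F0)[y Fy hy].
apply: (le_trans (Fy n n0 Jn An)).
rewrite (_ : _ + y = (n%:R * alpha + x) - (x - y)); last by ring.
by apply: (le_trans (dist_intB _ _)); rewrite lerD2l ltW.
Qed.

Lemma circle_mean_arc_lipschitz_ge phi s x r : 0 <= s -> circle_lipschitz s phi ->
  (forall y, 0 <= phi y <= 1) -> 0 <= r <= 2^-1 ->
  r * (phi (- x) - s * r) <= circle_mean (fun y => \1_(circle_arc x r) y * phi y).
Proof.
move=> s0 lip phi01 /andP[r0 r2].
have bphi : bounded_measurable phi.
  apply: (circle_lipschitz_bounded_measurable (M := 1) s0 lip) => y.
  by rewrite ler_norml; have /andP[? ?] := phi01 y; apply/andP; split; lra.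
have bI : bounded_measurable (\1_(circle_arc x r)).
  by apply: bounded_measurable_indic; exact: measurable_circle_arc.
have bM := bounded_measurableM bI bphi.
have I01 y : 0 <= \1_(circle_arc x r) y :> R by rewrite indicE.
set t := phi (- x) - s * r.
have [t0|t0] := leP t 0.
  apply: (@le_trans _ _ 0); first by rewrite mulr_ge0_le0.
  rewrite -[X in X <= _](circle_mean_cst 0); apply: ler_circle_mean => //.
    exact: bounded_measurable_cst.
  by move=> y _; rewrite mulr_ge0//; case/andP: (phi01 y).
apply: (@le_trans _ _ (circle_mean (fun y => t * \1_(circle_arc x r) y))).
  rewrite circle_meanZ// mulrC ler_wpM2l ?(ltW t0)//.
  by apply: circle_mean_arc_ge; rewrite r0.
apply: ler_circle_mean => //; first exact: bounded_measurableZ.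
move=> y _; rewrite mulrC indicE.
have [/set_mem hy|] := boolP (y \in _); last by rewrite !mul0r.
rewrite !mul1r /t; rewrite /circle_arc/= in hy.
have := lip (- x) y; rewrite -dist_intN opprB opprK addrC => h.
have h2 : s * dist_int (x + y) <= s * r by rewrite ler_wpM2l// ltW.
rewrite [y + x]addrC in h.
by move: h; rewrite ler_norml => /andP[? ?]; lra.
Qed.

(** Suppose that the set [F] has positive measure [m0], and let [g] count the arcs
    with index in [A] up to [N] that contain a given point, [S] being the sum of
    their radii. By equidistribution, the integral of [g] against a bump around
    [F] grows at least like [d * m0 * S]. But [g] is at most [J] on [F], and on
    the thin rim of the bump it cannot have that much mass, since its second
    moment is of order [S ^ 2]. *)
Lemma avoiding_set_null A alpha psi (d : R) J :
  badly_approximable alpha -> 0 < d ->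
  (forall n, (0 < n)%N -> 0 <= psi n) ->
  (forall n m, (0 < n)%N -> (n <= m)%N -> psi m <= psi n) ->
  (forall B, exists N, B <= \sum_(1 <= n < N.+1) psi n) ->
  (forall phi s eps, 0 < s -> circle_lipschitz s phi ->
    (forall y, 0 <= phi y <= 1) -> 0 < eps ->
    exists2 K, 0 <= K & forall N, (d * circle_mean phi - eps) * N%:R - K <=
      \sum_(1 <= n < N.+1) (A n)%:R * phi (- (n%:R * alpha))) ->
  circle_mean (\1_(avoiding_set A alpha psi J)) = 0.
Proof.
move=> [c c0 bad] d0 psi0 psi_decr div equi.
set F := avoiding_set A alpha psi J.
have mF : measurable F by exact: measurable_avoiding_set.
set m0 := circle_mean _.
have m00 : 0 <= m0 by exact: circle_mean_indic_ge0.
apply/eqP; rewrite eq_le m00 andbT leNgt; apply/negP => m0p.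
have F0 : F !=set0.
  apply/set0P/negP => /eqP F0; move: m0p; rewrite /m0 F0 indic0.
  by rewrite circle_mean_cst ltxx.
have dm0 : 0 < d * m0 by rewrite mulr_gt0.
(* The constants [tau], [d * m0 / 8], [eta] and the measure allowed for the rim
   are such that each of the four error terms is at most [d * m0 / 8 * S]. *)
set tau := c * (d * m0) / 192.
have tau0 : 0 < tau by rewrite divr_gt0// mulr_gt0.
have r0 : 0 < tau * (d * m0) / 4 by rewrite divr_gt0// mulr_gt0.
have [s s0 [mU hU]] :=
  tent_support_small F0 mF (fun x => @avoiding_set_closed A alpha psi J x F0) r0.
set U := _ `\` F in mU hU.
set phi := tent F s.
have lip : circle_lipschitz s phi by exact: tent_lipschitz (ltW s0).
have phi01 y : 0 <= phi y <= 1 by apply: tent01 => //; exact: ltW.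
have bphi : bounded_measurable phi.
  apply: (circle_lipschitz_bounded_measurable (M := 1) (ltW s0) lip) => y.
  by rewrite ler_norml; have /andP[? ?] := phi01 y; apply/andP; split; lra.
have m0phi : m0 <= circle_mean phi.
  apply: ler_circle_mean => //; first exact: bounded_measurable_indic.
  move=> y _; rewrite indicE; have [/set_mem Fy|_] := boolP (y \in F).
    by rewrite /phi tent_eq1.
  by case/andP: (phi01 y).
have eps0 : 0 < d * m0 / 8 by rewrite divr_gt0.
have [K K0 hK] := equi phi s _ s0 lip phi01 eps0.
pose eta := Num.min 2^-1 (d * m0 / (8 * s)).
have eta0 : 0 < eta.
  by rewrite lt_min invr_gt0 ltr0n/= divr_gt0// mulr_gt0.
have eta2 : eta <= 2^-1 by rewrite ge_min lexx.
have seta : s * eta <= d * m0 / 8.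
  apply: (@le_trans _ _ (s * (d * m0 / (8 * s)))).
    by rewrite ler_wpM2l ?(ltW s0)// ge_min lexx orbT.
  by rewrite le_eqVlt; apply/orP; left; apply/eqP; field; rewrite gt_eqF.
pose psi' n := Num.min (psi n) eta.
have psi'0 n : (0 < n)%N -> 0 <= psi' n.
  by move=> n0; rewrite le_min psi0// ltW.
have psi'_decr n m : (0 < n)%N -> (n <= m)%N -> psi' m <= psi' n.
  move=> n0 nm; rewrite /psi' le_min ge_min psi_decr//=.
  by rewrite ge_min lexx orbT.
have psi'eta n : psi' n <= eta by rewrite ge_min lexx orbT.
have div' := truncated_divergence eta0 psi0 psi_decr div.
have main N : 0 < \sum_(1 <= n < N.+1) psi' n ->
    (\sum_(1 <= n < N.+1) psi' n) * (d * m0 / 2) <= J%:R + 3 * tau + K.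
  set S := \sum_(_ <= _ < _) _ => S0.
  pose b n : R -> R := \1_(circle_arc (n%:R * alpha) (psi' n)).
  have bmb n : bounded_measurable (b n).
    by apply: bounded_measurable_indic; exact: measurable_circle_arc.
  pose g y := \sum_(1 <= n < N.+1) (A n)%:R * b n y.
  have bmg : bounded_measurable g.
    by apply: bounded_measurable_sum => n _; exact: bounded_measurableZ.
  have b01 n y : 0 <= b n y <= 1.
    by rewrite /b indicE; case: (_ \in _); rewrite /= ?lexx ?ler01.
  have g0 y : 0 <= g y.
    by apply: sumr_ge0 => n _; rewrite mulr_ge0//; case/andP: (b01 n y).
  have lower : (d * circle_mean phi - d * m0 / 8) * S - K - d * m0 / 8 * S <=
      circle_mean (fun y => g y * phi y).
    have -> : circle_mean (fun y => g y * phi y) =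
        \sum_(1 <= n < N.+1) (A n)%:R * circle_mean (fun y => b n y * phi y).
      transitivity (circle_mean (fun y =>
          \sum_(1 <= n < N.+1) (A n)%:R * (b n y * phi y))).
        congr circle_mean; apply/funext => y; rewrite /g mulr_suml.
        by apply: eq_bigr => n _; rewrite mulrA.
      rewrite circle_mean_sum => [|n _]; last first.
        exact/bounded_measurableZ/bounded_measurableM.
      by apply: eq_bigr => n _; rewrite circle_meanZ//; exact: bounded_measurableM.
    have abel := @abel_lower_bound R (fun n => (A n)%:R * phi (- (n%:R * alpha)))
      psi' (d * circle_mean phi - d * m0 / 8) K N psi'0 psi'_decr K0 hK.
    apply: (@le_trans _ _ (\sum_(1 <= n < N.+1) (A n)%:R * phi (- (n%:R * alpha)) * psi' n
        - \sum_(1 <= n < N.+1) d * m0 / 8 * psi' n)).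
      rewrite -mulr_sumr -/S lerD2r (le_trans _ abel)// -/S lerD2l lerN2.
      by rewrite ler_piMr//; have := psi'eta 1%N; lra.
    rewrite -sumrB; apply: ler_sum_nat => n /andP[n0 _].
    have r01 : 0 <= psi' n <= 2^-1.
      by rewrite psi'0//= (le_trans (psi'eta n)).
    have := circle_mean_arc_lipschitz_ge (n%:R * alpha) (ltW s0) lip phi01 r01.
    have h1 : psi' n * (s * psi' n) <= d * m0 / 8 * psi' n.
      rewrite mulrC ler_wpM2r ?psi'0// (le_trans _ seta)//.
      by rewrite ler_wpM2l ?(ltW s0).
    case: (A n); rewrite ?mul1r ?mul0r => h2; first by rewrite /b; lra.
    by rewrite sub0r oppr_le0 mulr_ge0 ?psi'0// ltW.
  have upper : circle_mean (fun y => g y * phi y) <=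
      J%:R + (tau / (2 * S) * (6 * S + 48 / c * S ^+ 2) +
              S / (2 * tau) * (tau * (d * m0) / 4)).
    have bg2 : bounded_measurable (fun y => g y ^+ 2).
      by under eq_fun do rewrite expr2; exact: bounded_measurableM.
    have bU : bounded_measurable (\1_U : R -> R) by exact: bounded_measurable_indic.
    apply: (@le_trans _ _ (circle_mean (fun y =>
        J%:R + (tau / (2 * S) * g y ^+ 2 + S / (2 * tau) * \1_U y)))).
      apply: ler_circle_mean.
      - exact: bounded_measurableM.
      - apply: bounded_measurableD; first exact: bounded_measurable_cst.
        by apply: bounded_measurableD; exact: bounded_measurableZ.
      move=> y _.
      have nn : 0 <= tau / (2 * S) * g y ^+ 2.
        by rewrite mulr_ge0 ?sqr_ge0// divr_ge0 ?mulr_ge0 ?ltW.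
      have nU : 0 <= S / (2 * tau) * \1_U y.
        by rewrite mulr_ge0 ?indicE// divr_ge0 ?mulr_ge0 ?ltW.
      have /andP[p0 p1] := phi01 y.
      have gphi : g y * phi y <= g y by rewrite ler_piMr.
      (* On [F] the bound is [J]; on the rim it is [norm_le_sqr]; elsewhere the
         bump vanishes. *)
      have [Fy|nFy] := pselect (F y).
        have gJ : g y <= J%:R.
          apply: (@le_trans _ _ (\sum_(1 <= n < N.+1) (n < J)%N%:R)).
            apply: ler_sum_nat => n /andP[n0 _].
            have [Jn|Jn] := leqP J n.
              have [An|] := boolP (A n); last by rewrite mul0r.
              rewrite mul1r /b indicE memNset//= /circle_arc/= => h.
              have := Fy n n0 Jn An; apply/negP; rewrite -ltNge (lt_le_trans h)//.
              by rewrite ge_min lexx.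
            have /andP[? ?] := b01 n y.
            by case: (A n); rewrite ?mul1r ?mul0r.
          exact: sum_ltn_ler.
        by apply: (le_trans (le_trans gphi gJ)); rewrite lerDl addr_ge0.
      have [p0'|p0'] := leP (phi y) 0.
        have -> : phi y = 0 by apply/le_anti; rewrite p0 p0'.
        by rewrite mulr0 addr_ge0// addr_ge0.
      have -> : \1_U y = 1 :> R by rewrite indicE mem_set.
      rewrite mulr1; have gT : g y <= tau / (2 * S) * g y ^+ 2 + S / (2 * tau).
        have T0 : 0 < S / tau by rewrite divr_gt0.
        have := norm_le_sqr (g y) T0; rewrite ger0_norm//.
        have -> : g y ^+ 2 / (2 * (S / tau)) = tau / (2 * S) * g y ^+ 2.
          by field; rewrite !gt_eqF.
        have -> // : S / tau / 2 = S / (2 * tau).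
        by field; rewrite gt_eqF.
      by apply: (le_trans (le_trans gphi gT)); rewrite lerDr.
    rewrite circle_meanD; [|exact: bounded_measurable_cst|
      by apply: bounded_measurableD; exact: bounded_measurableZ].
    rewrite circle_mean_cst lerD2l circle_meanD; try exact: bounded_measurableZ.
    rewrite !circle_meanZ// lerD//.
      rewrite ler_wpM2l//; first by rewrite divr_ge0 ?mulr_ge0 ?ltW.
      exact: (@second_moment R alpha c psi' N c0 bad psi'0 psi'_decr A).
    by rewrite ler_wpM2l// divr_ge0 ?mulr_ge0 ?ltW.
  have e1 : tau / (2 * S) * (6 * S + 48 / c * S ^+ 2) = 3 * tau + S * (d * m0 / 8).
    by rewrite /tau; field; rewrite !gt_eqF.
  have e2 : S / (2 * tau) * (tau * (d * m0) / 4) = S * (d * m0 / 8).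
    by field; rewrite gt_eqF.
  rewrite e1 e2 in upper.
  have h3 : d * m0 * S <= d * circle_mean phi * S.
    by rewrite ler_wpM2r ?(ltW S0)// ler_wpM2l// ltW.
  by have := le_trans lower upper; lra.
have [N hN] := div' ((J%:R + 3 * tau + K + 1) / (d * m0 / 2)).
have B0 : 0 < J%:R + 3 * tau + K + 1 by have : 0 <= J%:R :> R by []; lra.
have dm2 : 0 < d * m0 / 2 by rewrite divr_gt0.
have S0 : 0 < \sum_(1 <= n < N.+1) psi' n.
  by apply: lt_le_trans hN; rewrite divr_gt0.
have := main N S0; rewrite ler_pdivrMr// in hN.
by move=> h; have := le_trans hN h; lra.
Qed.

End Avoiding.

(** * Badly approximable numbers lie in the Kurzweil sets *)

Section BadSubset.
Variable R : realType.
Implicit Types (x y z r s : R) (psi : nat -> R).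
Local Opaque dist_int.
Notation mu := (@lebesgue_measure R).
Notation D := (`[0%R, 1%R[%classic : set R).

Lemma infinite_set_natP (S : set nat) :
  infinite_set S <-> forall k, exists2 n, (k <= n)%N & S n.
Proof.
split=> [iS k|h fS].
  apply: contrapT => hk; apply: iS; apply: (@sub_finite_set _ _ `I_k).
    move=> n Sn /=; rewrite ltnNge; apply/negP => kn; apply: hk.
    by exists n.
  exact: finite_II.
have [s Ss] := (finite_seqP _).1 fS.
have [n hn Sn] := h (\max_(i <- s) i).+1.
rewrite Ss/= in Sn; move: hn; rewrite ltnNge => /negP; apply.
exact: leq_bigmax_seq.
Qed.

Lemma approx_setE (A : set nat) psi alpha :
  approx_set A psi alpha = D `&` \bigcap_k \bigcup_(n in [set n | (k <= n)%N /\ A n])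
    [set y | dist_int (n%:R * alpha + y) <= psi n].
Proof.
apply/seteqP; split=> y.
  move=> [y01 /infinite_set_natP h]; split; first by rewrite /= in_itv.
  by move=> k _; have [n kn [An hn]] := h k; exists n.
move=> [/=]; rewrite in_itv/= => y01 h; split => //.
apply/infinite_set_natP => k; have [n [kn An] hn] := h k I.
by exists n.
Qed.

Lemma measurable_approx_set (A : set nat) psi alpha :
  measurable (approx_set A psi alpha).
Proof.
rewrite approx_setE; apply: measurableI; first exact: measurable_itv.
apply: bigcap_measurableType => k _.
apply: bigcup_measurable => n _; exact: measurable_dist_int_le.
Qed.

Lemma divergent_partial_sums psi :
  (forall n, (0 < n)%N -> 0 <= psi n) ->
  (\sum_(1 <= n <oo) (psi n)%:E = +oo)%E <->
  forall B, exists N, B <= \sum_(1 <= n < N.+1) psi n.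
Proof.
move=> psi0.
have psi0' n : (1 <= n)%N -> xpredT n -> (0 <= (psi n)%:E)%E.
  by move=> n1 _; rewrite lee_fin psi0.
split=> [div B|h].
  apply: contrapT => /forallNP hB.
  have : (\sum_(1 <= n <oo) (psi n)%:E <= B%:E)%E.
    apply: lime_le; first exact: is_cvg_nneseries.
    near=> N; have N0 : (0 < N)%N by near: N; exact: nbhs_infty_ge.
    rewrite sumEFin lee_fin -(prednK N0) leNgt; apply/negP => /ltW.
    exact: hB.
  by rewrite div leye_eq.
apply/eqyP => B B0; have [N hN] := h B.
apply: (@le_trans _ _ (\sum_(1 <= n < N.+1) (psi n)%:E)%E).
  by rewrite sumEFin lee_fin.
exact: (@nneseries_lim_ge R (fun n => (psi n)%:E) xpredT 1 N.+1 psi0').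
Unshelve. all: by end_near. Qed.

(** A point that lies in finitely many of the arcs avoids all of them from some
    index on. *)
Lemma full_measure_of_null_avoiding (a : pred nat) psi alpha :
  (forall J, circle_mean (\1_(avoiding_set a alpha psi J)) = 0) ->
  mu (approx_set [set n | posN n /\ a n] psi alpha) = 1%E.
Proof.
move=> null; set T := approx_set _ _ _.
have mT : measurable T by exact: measurable_approx_set.
have TD : T `<=` D by move=> y [y01 _]; rewrite /= in_itv.
pose F J := avoiding_set a alpha psi J `&` D.
have mF J : measurable (F J).
  by apply: measurableI; [exact: measurable_avoiding_set|exact: measurable_itv].
have F0 J : mu (F J) = 0%E.
  by rewrite /F -circle_mean_indic ?null//; exact: measurable_avoiding_set.
have DT : D `<=` T `|` \bigcup_J F J.
  move=> y Dy; have [Ty|nTy] := pselect (T y); [by left|right].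
  apply: contrapT => nF; apply: nTy; split; first by move: Dy; rewrite /= in_itv.
  apply/infinite_set_natP => k; apply: contrapT => hk; apply: nF.
  exists k => //; split => // n n0 kn an; rewrite leNgt; apply/negP => /ltW h.
  by apply: hk; exists n.
apply/le_anti/andP; split.
  rewrite -(circle_measure1 R); apply: le_measure; rewrite ?inE//.
rewrite -(circle_measure1 R).
have mUF : measurable (\bigcup_J F J) by exact: bigcupT_measurable.
apply: (@le_trans _ _ (mu (T `|` \bigcup_J F J))).
  apply: le_measure; rewrite ?inE//.
  by apply: measurableU.
apply: (@le_trans _ _ (mu T + mu (\bigcup_J F J))%E).
  exact: measureU2.
rewrite (_ : mu (\bigcup_J F J) = 0%E) ?adde0//.
apply/le_anti/andP; split; last exact: measure_ge0.
apply: (@le_trans _ _ (\sum_(0 <= J <oo) mu (F J))%E).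
  exact: measure_sigma_subadditive.
by rewrite eseries0.
Qed.

(** The arcs are centred at the points [- (n alpha)], so equidistribution is
    used for [- alpha]. *)
Lemma BAD_sub_kurzweil_set (V : finType) (f : nat -> V) (a : pred nat)
  (G : V -> V -> bool) (d K : R) psi alpha :
  (forall p m, prime p -> (0 < m)%N -> ~~ (p %| m)%N ->
    a (p * m)%N = G (f p) (f m)) ->
  0 < d -> (forall N, d * N%:R - K <= \sum_(1 <= n < N.+1) (a n)%:R) ->
  BAD R alpha -> divergent_decreasing R psi ->
  kurzweil_set [set n | posN n /\ a n] psi alpha.
Proof.
move=> ha d0 dens /BADP[alpha01 bad] [psi0 psi_decr div]; split => //.
apply: full_measure_of_null_avoiding => J.
apply: (@avoiding_set_null R a alpha psi d J bad d0 psi0 psi_decr) => //.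
  exact: (divergent_partial_sums psi0).1 div.
move=> phi s eps s0 lip phi01 eps0.
have badN := badly_approximableN bad.
have [K' K'0 hK'] := equidistribution_along ha badN s0 lip phi01 eps0.
have K0 : 0 <= K.
  by have := dens 0%N; rewrite big_geq// mulr0 sub0r oppr_le0.
exists (K' + K); first exact: addr_ge0.
move=> N; have := hK' N.
have phi1 y : `|phi y| <= 1.
  by rewrite ler_norml; have /andP[? ?] := phi01 y; apply/andP; split; lra.
have bphi := circle_lipschitz_bounded_measurable (ltW s0) lip phi1.
have m0 : 0 <= circle_mean phi.
  rewrite -[X in X <= _](circle_mean_cst 0); apply: ler_circle_mean => //.
    exact: bounded_measurable_cst.
  by move=> y _; case/andP: (phi01 y).
have m1 : circle_mean phi <= 1.
  rewrite -[X in _ <= X](circle_mean_cst 1); apply: ler_circle_mean => //.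
    exact: bounded_measurable_cst.
  by move=> y _; case/andP: (phi01 y).
have -> : \sum_(1 <= n < N.+1) (a n)%:R * (phi (n%:R * - alpha) - circle_mean phi) =
    \sum_(1 <= n < N.+1) (a n)%:R * phi (- (n%:R * alpha)) -
    \sum_(1 <= n < N.+1) (a n)%:R * circle_mean phi.
  by rewrite -sumrB; apply: eq_bigr => n _; rewrite mulrBr [n%:R * - alpha]mulrN.
rewrite -mulr_suml ler_norml => /andP[h _].
have h1 := ler_wpM2r m0 (dens N).
have h2 : K * circle_mean phi <= K by rewrite ler_piMr.
by lra.
Qed.

End BadSubset.

(** * Numbers that are not badly approximable *)

Section NotBad.
Variable R : realType.
Implicit Types (x y z r s : R) (psi : nat -> R).
Local Opaque dist_int.
Notation mu := (@lebesgue_measure R).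
Notation D := (`[0%R, 1%R[%classic : set R).

(** Multiples of a good denominator are still good, so good denominators can be
    taken large, even when [alpha] is rational. *)
Lemma large_good_denominator alpha (Q : nat) (e : R) :
  ~ badly_approximable alpha -> 0 < e ->
  exists q, [/\ (0 < q)%N, (Q <= q)%N & q%:R * dist_int (q%:R * alpha) <= e].
Proof.
move=> nbad e0.
have Q2 : 0 < Q.+1%:R ^+ 2 :> R by rewrite exprn_gt0.
have [n n0 hn] : exists2 n, (0 < n)%N &
    n%:R * dist_int (n%:R * alpha) < e / Q.+1%:R ^+ 2.
  apply: contrapT => h; apply: nbad; exists (e / Q.+1%:R ^+ 2).
    by rewrite divr_gt0.
  by move=> n n0; rewrite leNgt; apply/negP => lt; apply: h; exists n.
exists (Q.+1 * n)%N; split; first by rewrite muln_gt0.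
  by rewrite (leq_trans (leqnSn Q))// leq_pmulr.
have := dist_intMn Q.+1 (n%:R * alpha); rewrite mulrA -natrM => h.
apply: (le_trans (ler_wpM2l (ler0n _ _) h)).
rewrite ltr_pdivlMr// in hn; apply: le_trans (ltW hn).
by rewrite le_eqVlt; apply/orP; left; apply/eqP; rewrite natrM; ring.
Qed.

Section Construction.
Variables (alpha : R) (q : nat -> nat).
Hypothesis q0 : forall k, (0 < q k)%N.
Hypothesis q_ndecr : forall k, (q k <= q k.+1)%N.
Hypothesis q_good : forall k,
  (q k)%:R * dist_int ((q k)%:R * alpha) <= (2 ^+ (k + 7))^-1 ^+ 2.

(* On the block of indices that ends at [cutoff k] the weight is [1 / cutoff k],
   so every block has a mass of at least [1 / 2]. On the other hand, up to
   [cutoff k] the points [n alpha] deviate from only [q k] points, by at most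
   [2 ^ (k + 7)] times the distance from [q k * alpha] to the integers. *)
Let cutoff k := (q k * 2 ^ (k + 7))%N.

Lemma cutoff_gt0 k : (0 < cutoff k)%N.
Proof. by rewrite muln_gt0 q0 expn_gt0. Qed.

Lemma double_cutoff k : (2 * cutoff k <= cutoff k.+1)%N.
Proof. by rewrite /cutoff addSn expnS mulnCA leq_mul2r q_ndecr orbT. Qed.

Lemma cutoff_ndecr k l : (k <= l)%N -> (cutoff k <= cutoff l)%N.
Proof.
elim: l => [|l IH]; first by rewrite leqn0 => /eqP ->.
rewrite leq_eqVlt ltnS => /predU1P[->//|/IH h].
by rewrite (leq_trans h)// (leq_trans _ (double_cutoff l))// leq_pmull.
Qed.

Lemma cutoff_unbounded n : exists k, (n <= cutoff k)%N.
Proof.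
exists n; rewrite (leq_trans (ltnW (ltn_expl n (leqnn 2))))//.
by rewrite (@leq_trans (2 ^ (n + 7))%N)// ?leq_exp2l ?leq_addr// leq_pmull.
Qed.

Definition block n := ex_minn (cutoff_unbounded n).

Definition block_weight n : R := (cutoff (block n))%:R^-1.

Lemma block_le n k : (n <= cutoff k)%N -> (block n <= k)%N.
Proof. by rewrite /block; case: ex_minnP => m _ h /h. Qed.

Lemma le_cutoff_block n : (n <= cutoff (block n))%N.
Proof. by rewrite /block; case: ex_minnP. Qed.

Lemma block_weight_ge k n : (n <= cutoff k)%N -> (cutoff k)%:R^-1 <= block_weight n.
Proof.
move=> nk; rewrite /block_weight lef_pV2 ?posrE ?ltr0n ?cutoff_gt0// ler_nat.
exact/cutoff_ndecr/block_le.
Qed.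

Lemma block_weight_divergent : divergent_decreasing R block_weight.
Proof.
have bw0 n : (0 < n)%N -> 0 <= block_weight n by rewrite /block_weight invr_ge0.
split=> //.
  move=> n m _ nm; rewrite lef_pV2 ?posrE ?ltr0n ?cutoff_gt0// ler_nat.
  apply/cutoff_ndecr/block_le; exact: leq_trans nm (le_cutoff_block m).
apply/(divergent_partial_sums bw0) => B.
have h k : k%:R / 2 <= \sum_(1 <= n < (cutoff k).+1) block_weight n.
  elim: k => [|k IH].
    by rewrite mul0r big_nat_cond sumr_ge0// => n /andP[/andP[/bw0]].
  have kk : (cutoff k <= cutoff k.+1)%N by apply: cutoff_ndecr.
  rewrite (@big_cat_nat _ _ _ (cutoff k).+1 1 (cutoff k.+1).+1)//=.
  rewrite -natr1 mulrDl lerD// mul1r.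
  apply: (@le_trans _ _ (\sum_((cutoff k).+1 <= n < (cutoff k.+1).+1) (cutoff k.+1)%:R^-1)).
    rewrite sumr_const_nat subSS -[leRHS]mulr_natl.
    rewrite ler_pdivlMr ?ltr0n ?cutoff_gt0// ler_pdivrMl// -natrM ler_nat.
    by have := double_cutoff k; lia.
  by apply: ler_sum_nat => n /andP[_ nk]; exact: block_weight_ge.
exists (cutoff (Num.trunc (B * 2)).+1); apply: le_trans (h _).
by rewrite ler_pdivlMr// ltW// truncnS_gt.
Qed.

(* The arcs around the [q k] points [- (r alpha)] that cover all the arcs
   belonging to the block [k]. *)
Let cluster k : set R := \bigcup_(r in `I_(q k)) ([set y |
  dist_int (r%:R * alpha + y) <=
  (cutoff k)%:R^-1 + (2 ^+ (k + 7)) * dist_int ((q k)%:R * alpha)] `&` D).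

Lemma measurable_cluster k : measurable (cluster k).
Proof.
apply: bigcup_measurable => r _; apply: measurableI; last exact: measurable_itv.
exact: measurable_dist_int_le.
Qed.

(** The exponent [7] in the cutoff is chosen for this bound, whose sum over [k]
    is [1 / 2]. *)
Lemma measure_cluster k : (mu (cluster k) <= ((2 ^+ (k + 2))^-1)%:E)%E.
Proof.
set rho : R := (cutoff k)%:R^-1 + (2 ^+ (k + 7)) * dist_int ((q k)%:R * alpha).
have rho0 : 0 <= rho.
  by rewrite addr_ge0 ?invr_ge0// mulr_ge0 ?dist_int_ge0// exprn_ge0.
pose E (r : nat) : set R := [set y | dist_int (r%:R * alpha + y) <= rho] `&` D.
have mE (r : nat) : measurable (E r).
  apply: measurableI; last exact: measurable_itv.
  exact: measurable_dist_int_le.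
have -> : cluster k = \big[setU/set0]_(r < q k) E r.
  by rewrite /cluster -bigcup_mkord.
apply: (@le_trans _ _ (\sum_(r < q k) mu (E r))%E).
  elim: (q k) => [|n IH]; first by rewrite !big_ord0 measure0.
  rewrite !big_ord_recr/=.
  apply: (@le_trans _ _ (mu (\big[setU/set0]_(i < n) E i) + mu (E n))%E).
    by apply: measureU2; [apply: bigsetU_measurable => i _; exact: mE|exact: mE].
  by rewrite leeD2r.
apply: (@le_trans _ _ (\sum_(r < q k) (6 * rho)%:E)%E).
  by apply: lee_sum => i _; exact: measure_dist_int_le.
rewrite sumEFin lee_fin sumr_const card_ord -[_ *+ _]mulr_natl.
have qR : 0 < (q k)%:R :> R by rewrite ltr0n.
set L : R := 2 ^+ (k + 7).
have L0 : 0 < L by rewrite exprn_gt0.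
have -> : (q k)%:R * (6 * rho) = 6 * (L^-1 + L * ((q k)%:R * dist_int ((q k)%:R * alpha))).
  rewrite /rho /cutoff natrM natrX -/L.
  by field; rewrite !gt_eqF.
apply: (@le_trans _ _ (6 * (L^-1 + L * L^-1 ^+ 2))).
  by rewrite ler_pM2l// lerD2l ler_pM2l// q_good.
have -> : 6 * (L^-1 + L * L^-1 ^+ 2) = 12 * L^-1 by field; rewrite gt_eqF.
have -> : L = 32 * 2 ^+ (k + 2).
  by rewrite /L !exprD; set x := 2 ^+ k; ring.
have X0 : 0 < 2 ^+ (k + 2) :> R by rewrite exprn_gt0.
have Xi : 0 < (2 ^+ (k + 2))^-1 :> R by rewrite invr_gt0.
by rewrite invfM mulrA; lra.
Qed.

Lemma approx_block_weight_sub (A : set nat) : A `<=` posN ->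
  approx_set A block_weight alpha `<=` \bigcup_k cluster k.
Proof.
move=> Apos y [y01 /infinite_set_natP/(_ 0%N)[n _ [An hn]]].
exists (block n) => //; set k := block n.
exists (n %% q k)%N; first by rewrite /= ltn_mod.
split; last by rewrite /= in_itv.
rewrite /= (_ : _ + y = (n%:R * alpha + y) - (n %/ q k)%:R * ((q k)%:R * alpha)); last first.
  by rewrite [in n%:R](divn_eq n (q k)) natrD natrM; ring.
rewrite (le_trans (dist_intB _ _))// lerD//.
rewrite (le_trans (dist_intMn _ _))// ler_wpM2r ?dist_int_ge0//.
rewrite -natrX ler_nat -ltnS ltn_divLR// (leq_ltn_trans (le_cutoff_block n))//.
by rewrite /cutoff -/k mulnC ltn_mul2r q0/=.
Qed.

Lemma measure_approx_block_weight (A : set nat) : A `<=` posN ->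
  (mu (approx_set A block_weight alpha) < 1)%E.
Proof.
move=> Apos; apply: (@le_lt_trans _ _ (2^-1)%:E); last first.
  by rewrite lte_fin invf_lt1// ltr1n.
apply: (@le_trans _ _ (\sum_(0 <= k <oo) mu (cluster k))%E).
  apply: measure_sigma_subadditive; last exact: approx_block_weight_sub.
    exact: measurable_cluster.
  exact: measurable_approx_set.
apply: lime_le; first by apply: is_cvg_nneseries => n _ _; exact: measure_ge0.
apply: nearW => n.
apply: (@le_trans _ _ (\sum_(0 <= k < n) ((2 ^+ (k + 2))^-1)%:E)%E).
  by apply: lee_sum => k _; exact: measure_cluster.
rewrite sumEFin lee_fin.
suff -> : \sum_(0 <= k < n) (2 ^+ (k + 2))^-1 = 2^-1 - (2 ^+ (n + 1))^-1 :> R.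
  by rewrite gerBl invr_ge0 exprn_ge0.
elim: n => [|n IH]; first by rewrite big_geq// expr1 subrr.
rewrite big_nat_recr//= IH addSn [in RHS]exprS !exprD.
have X0 : 0 < 2 ^+ n :> R by rewrite exprn_gt0.
by field; rewrite gt_eqF.
Qed.

End Construction.

(** A number that is not badly approximable is rejected by the weight that is
    adapted to a sequence of its good denominators. *)
Lemma kurzweil_sub_BAD (A : set nat) : A `<=` posN ->
  \bigcap_(psi in divergent_decreasing R) kurzweil_set A psi `<=` BAD R.
Proof.
move=> Apos alpha halpha.
have one : divergent_decreasing R (fun=> 1).
  split=> //; apply/divergent_partial_sums => // B.
  exists (Num.trunc B).+1; rewrite sumr_const_nat subn1/=.
  by rewrite ltW// truncnS_gt.
have [alpha01 _] := halpha _ one.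
apply/BADP; split => //; apply: contrapT => nbad.
have e0 (k : nat) : 0 < (2 ^+ (k + 7))^-1 ^+ 2 :> R.
  by rewrite exprn_gt0// invr_gt0 exprn_gt0.
have [h hh] := choice (fun Qk : nat * nat => large_good_denominator Qk.1 nbad (e0 Qk.2)).
pose q := fix q k := if k is k'.+1 then h (q k', k) else h (0%N, 0%N).
have q0 k : (0 < q k)%N by case: k => [|k]; [have [] := hh (0, 0)%N|have [] := hh (q k, k.+1)].
have q_ndecr k : (q k <= q k.+1)%N by have [] := hh (q k, k.+1).
have q_good k : (q k)%:R * dist_int ((q k)%:R * alpha) <= (2 ^+ (k + 7))^-1 ^+ 2.
  by case: k => [|k]; [have [] := hh (0, 0)%N|have [] := hh (q k, k.+1)].
have [_ e] := halpha _ (block_weight_divergent q0 q_ndecr).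
have := measure_approx_block_weight q0 q_good Apos.
by rewrite e ltxx.
Qed.

End NotBad.

(** * Sets of positive lower density *)

Section Density.
Variable R : realType.

Definition dense_from_below (a : pred nat) :=
  exists d K : R, 0 < d /\
    forall N, d * N%:R - K <= \sum_(1 <= n < N.+1) (a n)%:R.

Lemma positive_lower_density_dense (a : pred nat) (A : set nat) :
  (forall n, (0 < n)%N -> A n <-> a n) ->
  positive_lower_density R A -> dense_from_below a.
Proof.
move=> Aa /limn_einf_gt0P[c c0 [n0 h]]; exists c, (c * n0%:R); split=> // N.
have e : (\sum_(1 <= n < N.+1) (n \in A))%N%:R = \sum_(1 <= n < N.+1) (a n)%:R :> R.
  rewrite natr_sum; apply: eq_big_nat => n /andP[n_gt0 _]; congr (_ %:R).
  congr nat_of_bool; apply/idP/idP; first by rewrite inE => /Aa; exact.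
  by rewrite inE => an; apply/Aa.
have [n0N|Nn0] := leqP n0 N.
  have [->|N0] := posnP N.
    by rewrite mulr0 sub0r (@le_trans _ _ 0) ?oppr_le0 ?sumr_ge0// mulr_ge0// ltW.
  have := h N n0N; rewrite e ler_pdivlMr ?ltr0n// => hN.
  by rewrite (le_trans _ hN)// gerBl mulr_ge0// ltW.
apply: (@le_trans _ _ 0); last by rewrite sumr_ge0.
by rewrite -mulrBr mulr_ge0_le0 ?(ltW c0)// subr_le0 ler_nat ltnW.
Qed.

Lemma sum_dilates_ler (F : nat -> R) t X N : (0 < t)%N -> (t * X <= N)%N ->
  (forall n, 0 <= F n) ->
  \sum_(1 <= n < X.+1) F (t * n)%N <= \sum_(1 <= n < N.+1) F n.
Proof.
move=> t0 tX F0.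
apply: (@le_trans _ _ (\sum_(1 <= n < N.+1) (t %| n)%:R * F n)); last first.
  by apply: ler_sum => n _; case: (t %| n)%N; rewrite ?mul1r ?mul0r.
rewrite sum_multiples// (@big_cat_nat _ _ _ X.+1 1 N.+1)//=; last first.
  by rewrite ltnS (leq_trans _ tX)// leq_pmull.
rewrite -[leLHS]addr0 lerD ?sumr_ge0// => [|n _]; last exact: mulr_ge0.
apply: ler_sum_nat => n /andP[_ nX].
by rewrite (leq_trans _ tX) ?mul1r// leq_mul2l -ltnS nX orbT.
Qed.

Lemma count_one_mod_ler P X : (0 < P)%N ->
  X%:R / P%:R <= \sum_(1 <= n < X.+1) (P %| n.-1)%N%:R :> R.
Proof.
move=> P0; rewrite ler_pdivrMr ?ltr0n// -natr_sum -natrM ler_nat.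
rewrite big_add1/=; case: X => // X.
rewrite big_nat_recl//= dvdn0 -(big_add1 _ _ 0 X.+1 xpredT (fun n => (P %| n)%N : nat)).
rewrite sum_dvdn// mulnDl mul1n; have := ltn_ceil X P0; rewrite mulSn; lia.
Qed.

(** The products of the first [i] members of a sequence of distinct primes. *)
Fixpoint prime_chain_prod i :=
  if i is j.+1 then (s2val (prime_above (prime_chain_prod j)) * prime_chain_prod j)%N
  else 1%N.

Lemma prime_chain_prod_gt0 i : (0 < prime_chain_prod i)%N.
Proof.
elim: i => //= i IH; rewrite muln_gt0 IH andbT.
by case: prime_above => p /= _ /prime_gt0.
Qed.

Lemma prime_chain_prod_dvd i j : (i <= j)%N -> (prime_chain_prod i %| prime_chain_prod j)%N.
Proof.
elim: j => [|j IH]; first by rewrite leqn0 => /eqP ->.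
rewrite leq_eqVlt ltnS => /predU1P[->//|/IH h].
by rewrite (dvdn_trans h)//= dvdn_mull.
Qed.

(** Let [P] be a product of [m] distinct primes. For [n] congruent to [1] modulo
    [P], the partial products of [P] multiply [n] into numbers at which [h] takes
    [m] consecutive values, so one of them falls into the given class; and a
    number arises at most once from each partial product. *)
Lemma additive_class_dense (h : nat -> nat) (a : int) (m : nat) : (0 < m)%N ->
  (forall p n, prime p -> (0 < n)%N -> ~~ (p %| n)%N -> h (p * n)%N = (h n).+1) ->
  dense_from_below (fun n => ((h n)%:Z == a %[mod m%:Z])%Z).
Proof.
move=> m0 hp; set c := fun n => _.
set P := prime_chain_prod m; have P0 : (0 < P)%N := prime_chain_prod_gt0 m.
have shift i n : (i <= m)%N -> (0 < n)%N -> (P %| n.-1)%N ->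
    h (prime_chain_prod i * n)%N = (i + h n)%N.
  move=> im n0 Pn; elim: i im => [|i IH] im; first by rewrite mul1n.
  rewrite addSn -IH ?(ltnW im)//= -mulnA.
  set p := s2val _.
  have [tp pp] : (prime_chain_prod i < p)%N /\ prime p.
    by rewrite /p; case: prime_above.
  apply: hp => //; first by rewrite muln_gt0 prime_chain_prod_gt0.
  rewrite Euclid_dvdM// negb_or gtnNdvd ?prime_chain_prod_gt0//=.
  apply/negP => pn; have pn1 : (p %| n.-1)%N.
    apply: dvdn_trans Pn; apply: dvdn_trans (prime_chain_prod_dvd im).
    by rewrite /= dvdn_mulr.
  have : (p %| 1)%N by rewrite -(dvdn_addr _ pn1) addn1 prednK.
  by rewrite dvdn1 => /eqP p1; rewrite p1 in pp.
have mR : 0 < m%:R :> R by rewrite ltr0n.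
have PR : 0 < P%:R :> R by rewrite ltr0n.
exists ((m%:R * P%:R ^+ 2)^-1), ((m%:R * P%:R)^-1).
split; first by rewrite invr_gt0 mulr_gt0// exprn_gt0.
move=> N; set X := (N %/ P)%N.
have hX : N%:R / P%:R - 1 <= X%:R :> R.
  rewrite lerBlDr ler_pdivrMr// natr1 -natrM ler_nat ltnW// ltn_ceil//.
set S := \sum_(1 <= n < N.+1) _.
(* [sum_dilates_ler] is the injectivity of multiplication by a partial product. *)
have each (i : 'I_m) :
    \sum_(1 <= n < X.+1) ((P %| n.-1)%N && c (prime_chain_prod i * n)%N)%:R <= S.
  apply: le_trans (@sum_dilates_ler (fun n => (c n)%:R) (prime_chain_prod i) X N
    (prime_chain_prod_gt0 i) _ (fun n => ler0n R (c n))).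
    by apply: ler_sum => n _; case: (P %| n.-1)%N => //=; rewrite ler0n.
  rewrite (@leq_trans (P * X)%N)//; last by rewrite mulnC leq_trunc_div.
  by rewrite leq_mul2r (dvdn_leq P0) ?orbT// prime_chain_prod_dvd// ltnW.
have cover : \sum_(1 <= n < X.+1) (P %| n.-1)%N%:R <=
    \sum_(i < m) \sum_(1 <= n < X.+1) ((P %| n.-1)%N && c (prime_chain_prod i * n)%N)%:R :> R.
  rewrite exchange_big/=; apply: ler_sum_nat => n /andP[n0 _].
  have [Pn|_] := boolP (P %| n.-1)%N; last by rewrite sumr_ge0.
  have mz : (m%:Z != 0)%R by rewrite eqz_nat -lt0n.
  have km : (`|((a - (h n)%:Z) %% m%:Z)%Z| < m)%N.
    by rewrite -ltz_nat gez0_abs ?modz_ge0// ltz_pmod.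
  rewrite (bigD1 (Ordinal km))//= (_ : c _) ?lerDl ?sumr_ge0//.
  rewrite /c shift ?(ltnW km)// PoszD gez0_abs ?modz_ge0//.
  by rewrite modzDml subrK.
have total : m%:R * S >= X%:R / P%:R.
  apply: (le_trans (count_one_mod_ler X P0)); apply: (le_trans cover).
  apply: (le_trans (ler_sum _ (fun i _ => each i))).
  by rewrite sumr_const card_ord -[leLHS]mulr_natl.
rewrite -(ler_pM2l mR); apply: le_trans total.
have -> : m%:R * ((m%:R * P%:R ^+ 2)^-1 * N%:R - (m%:R * P%:R)^-1) =
    (N%:R / P%:R - 1) / P%:R :> R.
  by field; rewrite !gt_eqF.
by rewrite ler_pM2r// invr_gt0.
Qed.

(** Adding the constant [c] turns the progression into the multiples of [m]. *)
Lemma arithmetic_progression_dense (a m : nat) : (0 < m)%N ->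
  dense_from_below (fun n => n == a %[mod m])%N.
Proof.
move=> m0; have mR : 0 < m%:R :> R by rewrite ltr0n.
exists m%:R^-1, 2; split; first by rewrite invr_gt0.
move=> N; set c := (m - a %% m)%N.
have am : (a %% m < m)%N by rewrite ltn_mod.
have e n : (n == a %[mod m]) = (m %| n + c)%N.
  rewrite -(eqn_modDr c) (_ : a + c = (a %/ m).+1 * m)%N ?modnMl//.
  rewrite {1}(divn_eq a m) mulSn /c; lia.
under eq_bigr do rewrite e.
have -> : \sum_(1 <= n < N.+1) (m %| n + c)%N%:R =
    \sum_(1 + c <= n < N.+1 + c) (m %| n)%N%:R :> R.
  by rewrite big_addn addnK.
have : \sum_(1 <= n < (N + c).+1) (m %| n)%N%:R = ((N + c) %/ m)%:R :> R.
  by rewrite -natr_sum sum_dvdn.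
rewrite (@big_cat_nat _ _ _ (1 + c) 1 (N + c).+1)//=; [|lia..].
rewrite -natr_sum add1n sum_dvdn// addSn => h.
have c1 : (c %/ m <= 1)%N.
  by rewrite -ltnS ltn_divLR// /c; lia.
have h1 : (c %/ m)%:R <= 1 :> R by rewrite -[leRHS]/(1%:R) ler_nat.
have h2 : N%:R <= ((N + c) %/ m)%:R * m%:R + m%:R :> R.
  rewrite -natrM -natrD ler_nat -mulSnr.
  by apply: (leq_trans (leq_addr c N)); rewrite ltnW// ltn_ceil.
have h3 : m%:R^-1 * N%:R <= ((N + c) %/ m)%:R + 1 :> R.
  by rewrite ler_pdivrMl// mulrDr mulr1 mulrC.
by rewrite -h in h3; lra.
Qed.

Definition squarefree n := ~~ has (fun p => p ^ 2 %| n)%N (primes n).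

Lemma squarefreeP n : (0 < n)%N ->
  reflect (forall p, prime p -> ~~ (p ^ 2 %| n)%N) (squarefree n).
Proof.
move=> n0; apply: (iffP idP) => [/hasPn h p pp|h].
  have [pn|pn] := boolP (p %| n)%N; first by apply: h; rewrite mem_primes pp n0.
  by apply: contra pn; apply: dvdn_trans; rewrite dvdn_exp.
by apply/hasPn => p; rewrite mem_primes => /andP[pp _]; exact: h.
Qed.

Lemma squarefree_mul_prime p n : prime p -> (0 < n)%N -> ~~ (p %| n)%N ->
  squarefree (p * n) = squarefree n.
Proof.
move=> pp n0 pn; have p0 := prime_gt0 pp.
have pn0 : (0 < p * n)%N by rewrite muln_gt0 p0.
apply/(squarefreeP pn0)/(squarefreeP n0) => h r rp; have := h r rp.
  by apply: contra; apply: dvdn_mull.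
apply: contra; have [->|rnp] := eqVneq r p.
  by rewrite expnS expn1 dvdn_pmul2l// (negbTE pn).
by rewrite Gauss_dvdr// coprimeXl// prime_coprime// dvdn_prime2.
Qed.

Lemma squarefree_dense : dense_from_below squarefree.
Proof.
exists (1 / 4), 0; split => // N.
have cover : (N <= \sum_(1 <= n < N.+1) squarefree n +
    \sum_(0 <= p < N.+1 | prime p) N %/ p ^ 2)%N.
  have -> : (\sum_(0 <= p < N.+1 | prime p) N %/ p ^ 2 =
    \sum_(1 <= n < N.+1) \sum_(0 <= p < N.+1 | prime p) (p ^ 2 %| n))%N.
    rewrite [RHS]exchange_big/=; apply: eq_bigr => p pp.
    by rewrite sum_dvdn ?expn_gt0 ?prime_gt0.
  rewrite -big_split/= -[X in (X <= _)%N]muln1 -[X in (X * _)%N]subn0 -subSS.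
  rewrite -sum_nat_const_nat big_nat_cond [leqRHS]big_nat_cond.
  apply: leq_sum => n; rewrite andbT => /andP[n0 nN].
  have [//|/negbNE/hasP[p]] := boolP (squarefree n).
  rewrite mem_primes add0n => /and3P[pp _ pn] p2.
  rewrite big_mkcond (bigD1_seq p) ?iota_uniq//=; last first.
    by rewrite mem_index_iota (leq_ltn_trans _ nN)// dvdn_leq.
  by rewrite pp p2.
have hc : (\sum_(0 <= p < N.+1 | prime p) N %/ p ^ 2)%N%:R <= N%:R * (3 / 4) :> R.
  rewrite natr_sum; apply: le_trans (ler_wpM2l (ler0n R N) (prime_sq_recip_sum R N.+1)).
  by rewrite mulr_sumr; apply: ler_sum => p _; exact: ler_divn.
rewrite -natr_sum.
have : N%:R <= (\sum_(1 <= n < N.+1) squarefree n +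
    \sum_(0 <= p < N.+1 | prime p) N %/ p ^ 2)%N%:R :> R by rewrite ler_nat.
by rewrite natrD; lra.
Qed.

End Density.

(** * Multiplicatively defined sets *)

Section Criterion.
Variable R : realType.

(** The form of the theorem that covers all the cases: whether [p m] belongs to
    the set must be determined by the values of [f] at [p] and at [m], for [f]
    with values in a finite type, which replaces multiplicativity. *)
Lemma kurzweil_eq_BAD (V : finType) (f : nat -> V) (a : pred nat)
  (G : V -> V -> bool) :
  (forall p m, prime p -> (0 < m)%N -> ~~ (p %| m)%N ->
    a (p * m)%N = G (f p) (f m)) ->
  dense_from_below R a ->
  \bigcap_(psi in divergent_decreasing R) kurzweil_set [set n | posN n /\ a n] psi
  = BAD R.
Proof.
move=> ha [d [K [d0 dens]]]; apply/seteqP; split.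
  by apply: kurzweil_sub_BAD => n [].
move=> alpha bad psi div; exact: (BAD_sub_kurzweil_set ha d0 dens bad div).
Qed.

Lemma kurzweil_set_eventually_sub (A B : set nat) (k : nat) psi (alpha : R) :
  (forall n, (k <= n)%N -> A n -> B n) ->
  kurzweil_set A psi alpha -> kurzweil_set B psi alpha.
Proof.
move=> AB [alpha01 hA]; split => //.
have sub : approx_set A psi alpha `<=` approx_set B psi alpha.
  move=> y [y01 /infinite_set_natP h]; split => //; apply/infinite_set_natP => l.
  have [n] := h (maxn k l); rewrite geq_max => /andP[kn ln] [An hn].
  by exists n => //; split => //; exact: AB.
apply/le_anti/andP; split.
  rewrite -(circle_measure1 R); apply: le_measure; rewrite ?inE//.
  - exact: measurable_approx_set.
  - by move=> y [y01 _]; rewrite /= in_itv.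
by rewrite -hA; apply: le_measure => //; rewrite inE; exact: measurable_approx_set.
Qed.

Lemma kurzweil_additive_class_eq_BAD (h : nat -> nat) (a : int) (m : nat) : (0 < m)%N ->
  (forall p n, prime p -> (0 < n)%N -> ~~ (p %| n)%N -> h (p * n)%N = (h n).+1) ->
  \bigcap_(psi in divergent_decreasing R)
    kurzweil_set [set n | posN n /\ ((h n)%:Z = a %[mod m%:Z])%Z] psi = BAD R.
Proof.
move=> m0 hp; have := additive_class_dense R a m0 hp; case: m m0 => // m _ dens.
pose f n : 'I_m.+1 := inord (h n %% m.+1).
pose G (_ w : 'I_m.+1) := ((w.+1)%:Z == a %[mod m.+1%:Z])%Z.
have ha p n : prime p -> (0 < n)%N -> ~~ (p %| n)%N ->
    ((h (p * n)%N)%:Z == a %[mod m.+1%:Z])%Z = G (f p) (f n).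
  move=> pp n0 pn; rewrite hp// /G /f inordK ?ltn_mod//.
  congr (_ == _); rewrite !modz_nat; congr Posz.
  by rewrite -[(h n).+1]addn1 -[(h n %% _).+1]addn1 modnDml.
have -> : [set n | posN n /\ ((h n)%:Z = a %[mod m.+1%:Z])%Z] =
    [set n | posN n /\ ((h n)%:Z == a %[mod m.+1%:Z])%Z].
  by apply/seteqP; split => n [n0 /eqP].
exact: kurzweil_eq_BAD ha dens.
Qed.

Lemma primes_mul_prime p n : prime p -> (0 < n)%N -> ~~ (p %| n)%N ->
  perm_eq (primes (p * n)) (p :: primes n).
Proof.
move=> pp n0 pn; apply: uniq_perm; rewrite /= ?primes_uniq//.
  by rewrite mem_primes pp n0 (negbTE pn).
by move=> q; rewrite (primesM _ (prime_gt0 pp) n0) primes_prime// !inE.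
Qed.

Lemma omega_mul_prime p n : prime p -> (0 < n)%N -> ~~ (p %| n)%N ->
  omega (p * n) = (omega n).+1.
Proof. by move=> pp n0 pn; rewrite /omega (perm_size (primes_mul_prime pp n0 pn)). Qed.

Lemma Omega_mul_prime p n : prime p -> (0 < n)%N -> ~~ (p %| n)%N ->
  Omega (p * n) = (Omega n).+1.
Proof.
move=> pp n0 pn; rewrite /Omega (perm_big _ (primes_mul_prime pp n0 pn)) big_cons.
have p0 := prime_gt0 pp.
rewrite lognM// logn_prime// eqxx lognE pp n0 (negbTE pn)/= addn0 add1n; congr _.+1.
apply: eq_big_seq => q; rewrite mem_primes => /and3P[qp _ qn].
rewrite lognM// logn_prime//; case: eqP => // e.
by rewrite -e qn in pn.
Qed.

Lemma moebius_squarefree n : moebius n ^+ 2 = 1 <-> squarefree n.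
Proof.
rewrite /moebius /squarefree; case: has => /=; last by rewrite sqrr_sign.
by rewrite expr0n.
Qed.

Lemma roots_of_unity_finite (m : nat) : (0 < m)%N ->
  exists s : seq R[i], forall z, roots_of_unity R m z -> z \in s.
Proof.
move=> m0; have [s hs] := closed_field_poly_normal ('X^m - 1 : {poly R[i]}).
exists s => z zm.
have p0 : ('X^m - 1 : {poly R[i]}) != 0 by rewrite monic_neq0 ?monicXnsubC.
have : root ('X^m - 1) z by rewrite /root !hornerE (zm : z ^+ m = 1) subrr.
by rewrite hs rootZ ?lead_coef_eq0// root_prod_XsubC.
Qed.

End Criterion.

Theorem corollary7 (R : realType) :
  [/\ forall (m : nat) (f : nat -> R[i]) (a : R[i]),
        (1 <= m)%N ->
        (forall n, posN n -> (roots_of_unity R m `|` [set 0]) (f n)) ->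
        multiplicative_fun f ->
        (roots_of_unity R m `|` [set 0]) a ->
        let A := [set n | posN n /\ f n = a] in
        positive_lower_density R A ->
        \bigcap_(psi in divergent_decreasing R) kurzweil_set A psi = BAD R,
      let A := [set n | posN n /\ moebius n ^+ 2 = 1] in
        \bigcap_(psi in divergent_decreasing R) kurzweil_set A psi = BAD R,
      forall (a : int) (m : nat), (1 <= m)%N ->
        let A := [set n | posN n /\ ((omega n)%:Z = a %[mod m%:Z])%Z] in
        \bigcap_(psi in divergent_decreasing R) kurzweil_set A psi = BAD R,
      forall (a : int) (m : nat), (1 <= m)%N ->
        let A := [set n | posN n /\ ((Omega n)%:Z = a %[mod m%:Z])%Z] in
        \bigcap_(psi in divergent_decreasing R) kurzweil_set A psi = BAD R
    & forall A : set nat,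
        A `<=` posN ->
        (exists m a : nat, [/\ posN m, posN a &
           [set (b * m + a)%N | b in posN] `<=` A]) ->
        \bigcap_(psi in divergent_decreasing R) kurzweil_set A psi = BAD R].
Proof.
split.
- move=> m f a m1 fm [f1 fM] _ A dens.
  have [s hs] := roots_of_unity_finite R m1.
  (* A finite type of values: positions in a list that contains all of them. *)
  pose s0 := 0 :: s.
  have fs n : (0 < n)%N -> f n \in s0.
    move=> n0; case: (fm n n0) => [/hs|->]; rewrite inE ?eqxx//.
    by move=> ->; rewrite orbT.
  pose F n : 'I_(size s).+1 := inord (index (f n) s0).
  have FE n : (0 < n)%N -> nth 0 s0 (F n) = f n.
    move=> /fs fn; have := fn; rewrite -index_mem => lt.
    by rewrite inordK ?nth_index.
  pose G (v w : 'I_(size s).+1) := nth 0 s0 v * nth 0 s0 w == a.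
  have ha p n : prime p -> (0 < n)%N -> ~~ (p %| n)%N ->
      (f (p * n)%N == a) = G (F p) (F n).
    move=> pp n0 pn; rewrite /G (FE p (prime_gt0 pp)) (FE n n0).
    rewrite (fM p n (prime_gt0 pp) n0)//.
    by rewrite prime_coprime.
  have -> : A = [set n | posN n /\ f n == a].
    by apply/seteqP; split => n [n0 /eqP].
  apply: (kurzweil_eq_BAD ha); apply: positive_lower_density_dense dens => n n0.
  by split=> [[_ /eqP]|/eqP].
- have ha p n : prime p -> (0 < n)%N -> ~~ (p %| n)%N ->
      squarefree (p * n) = squarefree n by exact: squarefree_mul_prime.
  have -> : [set n | posN n /\ moebius n ^+ 2 = 1] = [set n | posN n /\ squarefree n].
    by apply/seteqP; split => n [n0 /moebius_squarefree].
  exact: (kurzweil_eq_BAD (G := fun _ w => w) ha (squarefree_dense R)).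
- move=> a m m1 A; apply: kurzweil_additive_class_eq_BAD => // p n; exact: omega_mul_prime.
- move=> a m m1 A; apply: kurzweil_additive_class_eq_BAD => // p n; exact: Omega_mul_prime.
move=> A Apos [m [a [m0 a0 hA]]]; apply/seteqP; split.
  exact: kurzweil_sub_BAD.
case: m m0 hA => // m _ hA.
(* The residue modulo [m.+1] is completely multiplicative, and the progression
   is a full residue class up to finitely many terms. *)
pose f n : 'I_m.+1 := inord (n %% m.+1).
pose G (v w : 'I_m.+1) := (v * w == a %[mod m.+1])%N.
have ha p n : prime p -> (0 < n)%N -> ~~ (p %| n)%N ->
    (p * n == a %[mod m.+1])%N = G (f p) (f n).
  by move=> *; rewrite /G /f !inordK ?ltn_mod// modnMml modnMmr.
rewrite -(kurzweil_eq_BAD ha (arithmetic_progression_dense R a (ltn0Sn m))).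
move=> alpha halpha psi /halpha.
apply: (@kurzweil_set_eventually_sub R _ _ (a + m.+1)%N) => n an [_ /eqP na].
apply: hA; exists ((n - a) %/ m.+1)%N.
  by rewrite /posN/= divn_gt0//; lia.
have an' : (a <= n)%N by lia.
have : (m.+1 %| n - a)%N by rewrite -eqn_mod_dvd//; apply/eqP.
by move=> /divnK ->; rewrite subnK.
Qed.
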